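(* Let $\mathfrak g$ be a nilpotent Lie algebra of real dimension $2n\geq4$ with a quasi-nilpotent complex structure $J$, and let $F$ be a Hermitian metric on $(\mathfrak g,J)$. Then $(\mathfrak g,J)$ is a central extension of a $2\tilde n$-dimensional nilpotent Lie algebra with complex structure $(\tilde{\mathfrak g},\tilde J)$, with natural projection $\pi:\mathfrak g\to\tilde{\mathfrak g}$, and $F$ can be written as $F=\pi^*\tilde F+D$, where $\tilde F$ is a Hermitian metric on $(\tilde{\mathfrak g},\tilde J)$ and $D=\frac i2\big(\omega^{\tilde n+1}\wedge\overline{\omega^{\tilde n+1}}+\cdots+\omega^n\wedge\overline{\omega^n}\big)$, in terms of an adapted basis $\{\omega^k\}_{k=1}^n$ of $(1,0)$-forms as described in the context. Set $b=n-\tilde n$. Then: (i) $F$ is balanced on $(\mathfrak g,J)$ if and only if $\tilde F$ is balanced on $(\tilde{\mathfrak g},\tilde J)$ and $$\Big[(b-1)\tbinom{n-1}{b-1}\,\pi^*\tilde F^{\,n-b}\wedge D^{b-2}+b\tbinom{n-1}{b}\,\pi^*\tilde F^{\,n-1-b}\wedge D^{b-1}\Big]\wedge dD=0.$$ (ii) $F$ is astheno-Kähler on $(\mathfrak g,J)$ if and only if $\tilde F$ is astheno-Kähler on $(\tilde{\mathfrak g},\tilde J)$ and $$\begin{aligned}0=\ &\Big[b\tbinom{n-2}{b}\pi^*(\bar\partial\tilde F^{\,n-2-b})\wedge D^{b-1}+(b-1)\tbinom{n-2}{b-1}\pi^*(\bar\partial\tilde F^{\,n-1-b})\wedge D^{b-2}\Big]\wedge\partial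 D\\&-\Big[b\tbinom{n-2}{b}\pi^*(\partial\tilde F^{\,n-2-b})\wedge D^{b-1}+(b-1)\tbinom{n-2}{b-1}\pi^*(\partial\tilde F^{\,n-1-b})\wedge D^{b-2}\Big]\wedge\bar\partial D\\&-\Big[b(b-1)\tbinom{n-2}{b}\pi^*\tilde F^{\,n-2-b}\wedge D^{b-2}+(b-1)(b-2)\tbinom{n-2}{b-1}\pi^*\tilde F^{\,n-1-b}\wedge D^{b-3}\\&\qquad+(b-2)(b-3)\tbinom{n-2}{b-2}\pi^*\tilde F^{\,n-b}\wedge D^{b-4}\Big]\wedge\partial D\wedge\bar\partial D\\&-\Big[b\tbinom{n-2}{b}\pi^*\tilde F^{\,n-2-b}\wedge D^{b-1}+(b-1)\tbinom{n-2}{b-1}\pi^*\tilde F^{\,n-1-b}\wedge D^{b-2}\\&\qquad+(b-2)\tbinom{n-2}{b-2}\pi^*\tilde F^{\,n-b}\wedge D^{b-3}\Big]\wedge\partial\bar\partial D.\end{aligned}$$ Here the conventions $\tilde F^0=1=D^0$ and $\tilde F^\lambda=0=D^\lambda$ for $\lambda<0$ are used.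
   Context: A complex structure on a Lie algebra $\mathfrak g$ is an endomorphism $J$ with $J^2=-\mathrm{Id}$ and vanishing Nijenhuis tensor. For $\mathfrak g$ nilpotent, $J$ is quasi-nilpotent if $\mathfrak a_1(J)=\mathcal Z(\mathfrak g)\cap J(\mathcal Z(\mathfrak g))\neq\{0\}$, where $\mathcal Z(\mathfrak g)$ is the center. $(\mathfrak g,J)$ is a central extension of $(\tilde{\mathfrak g},\tilde J)$ if there is a proper $J$-invariant ideal $\mathfrak b\subset\mathcal Z(\mathfrak g)$ (with $\{0\}\neq\mathfrak b\neq\mathfrak g$) such that $\mathfrak g/\mathfrak b$ with the induced complex structure is isomorphic to $(\tilde{\mathfrak g},\tilde J)$ via a Lie algebra isomorphism commuting with the complex structures; $\pi:\mathfrak g\to\tilde{\mathfrak g}$ is the resulting projection, and $\dim_{\mathbb R}\mathfrak b=2b$. Adapted basis: given any basis $\{\tilde\omega^k\}_{k=1}^{\tilde n}$ of $(1,0)$-forms on $(\tilde{\mathfrak g},\tilde J)$, there exists (as shown in a preceding lemma of the paper) a basis $\{\omega^k\}_{k=1}^n$ of $(1,0)$-forms on $(\mathfrak g,J)$ with $\omega^k=\pi^*\tilde\omega^k$ for $1\leq k\leq\tilde n$, with $d\omega^j\in\Lambda^{2}\langle\omega^1,\dots,\omega^{\tilde n},\overline{\omega^1},\dots,\overline{\omega^{\tilde n}}\rangle$ of type $(2,0)+(1,1)$ for all $1\leq j\leq n$, and such that $F=\pi^*\tilde F+D$ with $\tilde F$ and $D$ as in the claim. A Hermitian metric on $(\mathfrak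 g,J)$ is identified with its fundamental form, a real positive $(1,1)$-form $F\in\Lambda^{1,1}\mathfrak g^*$; differentials are Chevalley-Eilenberg differentials, $d=\partial+\bar\partial$. In complex dimension $m$, a Hermitian metric $H$ is balanced if $dH^{m-1}=0$ and astheno-Kähler if $\partial\bar\partial H^{m-2}=0$ (with the conventions $H^0=1$, $H^\lambda=0$ for $\lambda<0$). *)

(* Defs.v *)
From HB Require Import structures.
From mathcomp Require Import all_boot all_order all_algebra.
From mathcomp Require Import complex.
From mathcomp Require Import boolp functions reals.

Set Implicit Arguments.
Unset Strict Implicit.
Unset Printing Implicit Defensive.

Import Order.TTheory GRing.Theory Num.Theory.
Local Open Scope ring_scope.

Record lieAlgebra (R : realType) := LieAlgebra {
  lie_space :> vectType R;
  lie_bracket : lie_space -> lie_space -> lie_space;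
  lie_linear_l : forall y, linear (lie_bracket^~ y);
  lie_linear_r : forall x, linear (lie_bracket x);
  lie_alternating : forall x, lie_bracket x x = 0;
  lie_jacobi : forall x y z,
    lie_bracket x (lie_bracket y z) + lie_bracket y (lie_bracket z x)
      + lie_bracket z (lie_bracket x y) = 0 }.

Notation "'lie[' x , y ]" := (lie_bracket x y)
  (at level 0, x at level 99, y at level 99, format "'lie[' x ,  y ]").

Section LieAlgebra.
Variables (R : realType) (g : lieAlgebra R).
Implicit Types (x y z : g) (U V : {vspace g}) (J : 'End(g)).

HB.instance Definition _ x :=
  GRing.isLinear.Build R g g *:%R (lie_bracket x) (lie_linear_r x).

Definition ad x : 'End(g) := linfun (lie_bracket x).

Lemma ad_linear : linear ad.
Proof.
move=> a x y; apply/lfunP => z.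
by rewrite add_lfunE scale_lfunE !lfunE /= lie_linear_l.
Qed.

HB.instance Definition _ := GRing.isLinear.Build R g 'End(g) *:%R ad ad_linear.

Definition lie_center : {vspace g} := lker (linfun ad).

Lemma lie_centerP x : reflect (forall y, lie[x, y] = 0) (x \in lie_center).
Proof.
rewrite memv_ker lfunE; apply: (iffP eqP) => [adx0 y | br0].
  by have := congr1 (fun f : 'End(g) => f y) adx0; rewrite lfunE zero_lfunE.
by apply/lfunP => y; rewrite zero_lfunE lfunE /= br0.
Qed.

(* The span of all lie[u, v] with u in U and v in V; by bilinearity it is enough
   to let u and v range over bases. *)
Definition lie_product U V : {vspace g} :=
  <<[seq lie[u, v] | u <- vbasis U, v <- vbasis V]>>%VS.

Lemma mem_lie_product U V x y :
  x \in U -> y \in V -> lie[x, y] \in lie_product U V.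
Proof.
move=> Ux Vy; rewrite (coord_vbasis Vy) linear_sum /=.
apply: memv_suml => j _; rewrite linearZ /=; apply: memvZ.
rewrite (coord_vbasis Ux).
have -> : lie[\sum_i coord (vbasis U) i x *: (vbasis U)`_i, (vbasis V)`_j]
        = \sum_i coord (vbasis U) i x *: lie[(vbasis U)`_i, (vbasis V)`_j].
  have E z : lie[z, (vbasis V)`_j] = linfun ad z (vbasis V)`_j.
    by rewrite !lfunE.
  rewrite E linear_sum sum_lfunE; apply: eq_bigr => i _.
  by rewrite linearZ /= scale_lfunE -E.
apply: memv_suml => i _; apply: memvZ; apply: memv_span.
by apply: allpairs_f; apply: mem_nth; rewrite size_tuple.
Qed.

Fixpoint lower_central (k : nat) : {vspace g} :=
  if k is k'.+1 then lie_product fullv (lower_central k') else fullv.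

Definition lie_nilpotent : Prop := exists k, lower_central k = 0%VS.

Definition lie_ideal U : Prop :=
  forall x y, y \in U -> lie[x, y] \in U.

Definition nijenhuis J x y : g :=
  lie[J x, J y] - J lie[J x, y] - J lie[x, J y] - lie[x, y].

Definition complex_structure J : Prop :=
  (forall x, J (J x) = - x) /\ (forall x y, nijenhuis J x y = 0).

Definition quasi_nilpotent J : Prop :=
  (lie_center :&: J @: lie_center)%VS != 0%VS.

End LieAlgebra.

Arguments lie_center {R} g.
Arguments lie_nilpotent {R} g.

(* A Lie algebra isomorphism from the quotient g / b to h is the same thing as
   a surjective Lie algebra morphism pi : g -> h with kernel b. It commutes with
   the complex structures (the one of g / b being induced by J) exactly when pi
   does. *)
Definition central_extension (R : realType) (g h : lieAlgebra R)
    (J : 'End(g)) (Jh : 'End(h)) (pi : 'Hom(g, h)) : Prop :=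
  (exists b : {vspace g},
     [/\ lie_ideal b, (b <= lie_center g)%VS, (J @: b <= b)%VS,
         b != 0%VS /\ b != fullv & lker pi = b]) /\
  [/\ limg pi = fullv,
      forall x y, pi lie[x, y] = lie[pi x, pi y] &
      forall x, pi (J x) = Jh (pi x)].

(* A complex-valued form on g, possibly of mixed degree, is represented by its
   values on finite sequences of vectors: its component of degree k is the
   restriction to the sequences of size k. *)
Definition cform (R : realType) (g : lieAlgebra R) : Type := seq g -> R[i].

HB.instance Definition _ (R : realType) (g : lieAlgebra R) :=
  GRing.Lmodule.copy (cform g) (seq g -> R[i]).

Section Forms.
Variables (R : realType) (g : lieAlgebra R).
Implicit Types (f : cform g) (J : 'End(g)) (s : seq g).

(* f belongs to the k-th exterior power of the complexified dual of g. *)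
Definition is_form (k : nat) f : Prop :=
  [/\ forall s, size s != k -> f s = 0,
      forall s, ~~ uniq s -> f s = 0 &
      forall s1 s2 (a : R) (u v : g),
        f (s1 ++ (a *: u + v) :: s2)
        = (a%:C)%C * f (s1 ++ u :: s2) + f (s1 ++ v :: s2)].

Definition form1 : cform g := fun s => if s is [::] then 1 else 0.

(* The number of pairs i < j such that m_i = false and m_j = true, that is, the
   number of inversions of the shuffle moving the entries selected by m in
   front of the other ones. *)
Fixpoint shuffle_inv (m : bitseq) : nat :=
  if m is b :: m' then ((if b then 0 else count id m') + shuffle_inv m')%N
  else 0%N.

(* The wedge product as a signed sum over shuffles, normalized so that
   (a ^ b)(x, y) = a(x) b(y) - a(y) b(x) for forms a and b of degree 1. *)
Definition wedge (f1 f2 : cform g) : cform g := fun s =>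
  \sum_(m : (size s).-tuple bool)
    (-1) ^+ shuffle_inv m * f1 (mask m s) * f2 (mask (map negb m) s).

Definition wedge_pow f (k : int) : cform g :=
  match k with
  | Posz m => iter m (wedge f) form1
  | Negz _ => 0
  end.

Definition conj_form f : cform g := fun s => ((f s)^*)%C.

(* The sequence s without its entries of indices i and j. *)
Definition omit2 s (i j : nat) : seq g :=
  [seq s`_k | k <- iota 0 (size s) & (k != i) && (k != j)].

(* The Chevalley-Eilenberg differential (trivial coefficients). *)
Definition dform f : cform g := fun s =>
  \sum_(i < size s) \sum_(j < size s | (i < j)%N)
    (-1) ^+ (i + j) * f (lie[s`_i, s`_j] :: omit2 s i j).

(* The component of type (p, q). The two terms of the recursive case are the
   contractions with the components (v - i J v) / 2 and (v + i J v) / 2 of v of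
   type (1, 0) and (0, 1) in the complexification of g. *)
Fixpoint type_part_rec J (p q : nat) f s : R[i] :=
  match s with
  | [::] => if (p == 0%N) && (q == 0%N) then f [::] else 0
  | v :: s' =>
      (if p is p'.+1 then
         type_part_rec J p' q
           (fun t => (f (v :: t) - 'i%C * f (J v :: t)) / 2%:R) s'
       else 0)
    + (if q is q'.+1 then
         type_part_rec J p q'
           (fun t => (f (v :: t) + 'i%C * f (J v :: t)) / 2%:R) s'
       else 0)
  end.

Definition type_part J (p q : nat) f : cform g := type_part_rec J p q f.

Definition is_pq_form J (p q : nat) f : Prop :=
  is_form (p + q) f /\ type_part J p q f = f.

(* On forms of type (p, q), del is the component of type (p + 1, q) of the
   differential and delbar the one of type (p, q + 1); both are extended
   additively. *)
Definition del J f : cform g := fun s =>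
  \sum_(p < size s)
    let q := (size s - p.+1)%N in
    type_part J p.+1 q (dform (type_part J p q f)) s.

Definition delbar J f : cform g := fun s =>
  \sum_(p < size s)
    let q := (size s - p.+1)%N in
    type_part J p q.+1 (dform (type_part J p q f)) s.

Definition hermitian_metric J (F : cform g) : Prop :=
  [/\ is_pq_form J 1 1 F,
      conj_form F = F &
      forall v : g, v != 0 -> 0 < F [:: v; J v]].

Definition complex_dim : nat := (\dim {:g})./2.

Definition balanced (F : cform g) : Prop :=
  dform (wedge_pow F (complex_dim%:Z - 1)) = 0.

Definition astheno_kahler J (F : cform g) : Prop :=
  del J (delbar J (wedge_pow F (complex_dim%:Z - 2))) = 0.

Definition basis_10 J (m : nat) (w : 'I_m -> cform g) : Prop :=
  (forall k, is_pq_form J 1 0 (w k)) /\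
  (forall a : cform g, is_pq_form J 1 0 a ->
     exists! c : {ffun 'I_m -> R[i]}, a = \sum_k c k *: w k).

(* f is in the second exterior power of the span of the forms t i. *)
Definition in_wedge2_span (I : finType) (t : I -> cform g) f : Prop :=
  exists c : I -> I -> R[i], f = \sum_i \sum_j c i j *: wedge (t i) (t j).

(* With 0-based indices, the sum runs over the last n - m forms. *)
Definition vertical_form (m n : nat) (w : 'I_n -> cform g) : cform g :=
  ('i%C / 2%:R) *:
    \sum_(k < n | (m <= k)%N) wedge (w k) (conj_form (w k)).

End Forms.

Notation "a ^w b" := (wedge a b) (at level 40, left associativity).
Notation "a ^^w k" := (wedge_pow a k) (at level 30).

Definition pullback (R : realType) (g h : lieAlgebra R) (pi : 'Hom(g, h))
  (f : cform h) : cform g := fun s => f (map pi s).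

Definition adapted_basis (R : realType) (g h : lieAlgebra R)
    (J : 'End(g)) (pi : 'Hom(g, h)) (m n : nat)
    (wh : 'I_m -> cform h) (w : 'I_n -> cform g) : Prop :=
  [/\ basis_10 J w,
      forall (k : 'I_n) (l : 'I_m), k = l :> nat -> w k = pullback pi (wh l) &
      forall j : 'I_n,
        in_wedge2_span
          (fun x : 'I_m + 'I_m => match x with
             | inl l => pullback pi (wh l)
             | inr l => conj_form (pullback pi (wh l))
             end) (dform (w j)) /\
        dform (w j)
        = type_part J 2 0 (dform (w j)) + type_part J 1 1 (dform (w j))].

(* Main.v *)
Require Import Defs.
From HB Require Import structures.
From mathcomp Require Import all_boot all_order all_algebra.
From mathcomp Require Import complex ring zify.
From mathcomp Require Import boolp functions reals.

Set Implicit Arguments.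
Unset Strict Implicit.
Unset Printing Implicit Defensive.

Import Order.TTheory GRing.Theory Num.Theory.
Local Open Scope ring_scope.

(** A form is a function on sequences, so contraction with a vector [v] is
    [f (v :: _)], and the shuffle product satisfies
    [i_v (a ^ b) = i_v a ^ b + (-1)^|a| a ^ i_v b] for arbitrary functions.
    Induction on the sequence then makes [cform g] an associative algebra in which
    even elements are central, and gives the Leibniz rules for [d] (through
    Cartan's formula) and for [del], [delbar] (through the type components).

    Since [pi^* Ft ^ (nt + 1) = 0] and [D ^ (b + 1) = 0], at most three terms of the
    binomial expansions of [F ^ (n - 1)] and [F ^ (n - 2)] survive. After
    differentiation, the term [pi^* (d Ft ^ (nt - 1)) D ^ b] (respectively
    [pi^* (del delbar Ft ^ (nt - 2)) D ^ b]) is the only one that does not vanish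
    when [2 b] arguments lie in [ker pi]: that kernel being central, [dD] vanishes
    on two vertical vectors. As [D ^ b] is nonzero on [ker pi] by positivity, this
    term must vanish by itself. The remaining unwanted term
    [del delbar Ft ^ (nt - 1)] is zero because nilpotent algebras are unimodular.

    The splitting [F = pi^* Ft + D] is obtained by subtracting from [F] one square
    [i/2 t ^ t-bar] at a time, with [t x = F(x, J e) - i F(x, e)] for a unit vector
    [e] of [ker pi]; each step enlarges the radical of [F] by the plane of
    [e] and [J e]. *)

(** The separation of terms is a count of vertical arguments, that is, of arguments in ker pi: a
    pulled back form has degree 0, a factor [D] at most 2, each of dD, del D, delbar D and del
    delbar D at most 1. Differentiating a factor [D] therefore costs at least one vertical argument,
    and only a term with an undifferentiated D^b can reach 2b. The coefficient of that term is
    C(n-1, b) or C(n-2, b), which is nonzero and can be cancelled, except for nt = 1 in (ii), where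
    the condition on the base is void.

    This count cannot remove pi^* (del delbar Ft^(nt-1)) D^(b-1), whose vertical degree is too low.
    Its absence from (ii) needs another reason, and that is where unimodularity enters; the
    analogous term d Ft^nt of (i) vanishes by degree alone.

    Powers are kept with integer exponents: since negative powers are 0, the rule d D^k = k D^(k-1)
    dD holds for every integer k, and small values of b are not exceptional. *)

Lemma big_tuple_cons (V : nmodType) (n : nat) (T : n.+1.-tuple bool -> V) :
  \sum_(m : n.+1.-tuple bool) T m
  = \sum_(m : n.-tuple bool) T [tuple of true :: m]
    + \sum_(m : n.-tuple bool) T [tuple of false :: m].
Proof.
rewrite (reindex (fun p : bool * n.-tuple bool => [tuple of p.1 :: p.2])) /=.
  rewrite -(pair_bigA _ (fun b (m : n.-tuple bool) => T [tuple of b :: m])) /=.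
  by rewrite big_bool.
exists (fun t => (thead t, [tuple of behead t])) => [[b m] _|t _] /=.
  by congr (_, _); apply: val_inj.
by rewrite [RHS]tuple_eta; apply: val_inj.
Qed.

(** * The algebra of forms *)

Section Algebra.
Variables (R : realType) (g : lieAlgebra R).
Implicit Types (f a b c : cform g) (s t : seq g) (u v x : g) (z : R[i]).

Definition contract v f : cform g := fun s => f (v :: s).

(** The grading involution: it carries the sign (-1)^|a| of the graded rules, which then hold for
    forms of mixed degree. *)
Definition parity f : cform g := fun s => (-1) ^+ size s * f s.

Lemma cformD a b s : (a + b) s = a s + b s. Proof. by []. Qed.
Lemma cformN a s : (- a) s = - a s. Proof. by []. Qed.
Lemma cformZ z a s : (z *: a) s = z * a s. Proof. by []. Qed.
Lemma cform0 s : (0 : cform g) s = 0. Proof. by []. Qed.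
Lemma cform_sum (I : Type) (r : seq I) (P : pred I) (G : I -> cform g) s :
  (\sum_(i <- r | P i) G i) s = \sum_(i <- r | P i) G i s.
Proof. exact: (big_morph (fun a => a s)). Qed.

Lemma contract_is_linear v : linear (contract v). Proof. by []. Qed.
HB.instance Definition _ v :=
  GRing.isLinear.Build R[i] (cform g) (cform g) *:%R (contract v)
    (contract_is_linear v).

Lemma parity_is_linear : linear parity.
Proof.
move=> z a b; apply/funext => s.
by rewrite /parity !(cformD, cformZ) mulrDr mulrCA.
Qed.
HB.instance Definition _ :=
  GRing.isLinear.Build R[i] (cform g) (cform g) *:%R parity parity_is_linear.

Lemma contractD v a b : contract v (a + b) = contract v a + contract v b.
Proof. by []. Qed.
Lemma contractN v a : contract v (- a) = - contract v a.
Proof. by []. Qed.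
Lemma contractZ v z a : contract v (z *: a) = z *: contract v a.
Proof. by []. Qed.
Lemma parityN a : parity (- a) = - parity a.
Proof. exact: linearN. Qed.
Lemma parityD a b : parity (a + b) = parity a + parity b.
Proof. exact: linearD. Qed.
Lemma parityZ z a : parity (z *: a) = z *: parity a.
Proof. exact: linearZ. Qed.

Lemma parityK : involutive parity.
Proof. by move=> a; apply/funext=> s; rewrite /parity signrMK. Qed.

Lemma contract_parity v a : contract v (parity a) = - parity (contract v a).
Proof. by apply/funext=> s; rewrite /contract /parity /= exprS !mulN1r mulNr. Qed.

Lemma wedge_nil a b : wedge a b [::] = a [::] * b [::].
Proof.
rewrite /wedge (big_pred1 [tuple]) /=; first by rewrite mul1r.
by move=> t; rewrite [t]tuple0; apply/esym/eqP.
Qed.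

(** In a shuffle the first vector goes either to [a] or to [b]; in the second case it is inverted
    with every argument of [a], and [parity] records that sign. *)
Lemma wedge_cons a b v s :
  wedge a b (v :: s)
  = wedge (contract v a) b s + wedge (parity a) (contract v b) s.
Proof.
rewrite /wedge big_tuple_cons; congr (_ + _); apply: eq_bigr => m _ //=.
rewrite exprD /parity size_mask ?size_tuple // /contract.
by congr (_ * _); ring.
Qed.

Lemma contract_wedge v a b :
  contract v (wedge a b)
  = wedge (contract v a) b + wedge (parity a) (contract v b).
Proof. by apply/funext=> s; rewrite {1}/contract wedge_cons. Qed.

Lemma wedgeDl : left_distributive (@wedge R g) +%R.
Proof.
move=> a b c; apply/funext => s; rewrite cformD /wedge -big_split /=.
by apply: eq_bigr => m _; rewrite cformD mulrDr mulrDl.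
Qed.

Lemma wedgeDr : right_distributive (@wedge R g) +%R.
Proof.
move=> a b c; apply/funext => s; rewrite cformD /wedge -big_split /=.
by apply: eq_bigr => m _; rewrite cformD mulrDr.
Qed.

Lemma wedgeZl z a b : wedge (z *: a) b = z *: wedge a b.
Proof.
apply/funext => s; rewrite cformZ /wedge mulr_sumr /=.
by apply: eq_bigr => m _; rewrite cformZ; ring.
Qed.

Lemma wedgeZr z a b : wedge a (z *: b) = z *: wedge a b.
Proof.
apply/funext => s; rewrite cformZ /wedge mulr_sumr /=.
by apply: eq_bigr => m _; rewrite cformZ; ring.
Qed.

Lemma wedge0l a : wedge 0 a = 0.
Proof. by have := wedgeZl 0 0 a; rewrite !scale0r. Qed.
Lemma wedge0r a : wedge a 0 = 0.
Proof. by have := wedgeZr 0 a 0; rewrite !scale0r. Qed.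

Lemma wedgeNl a b : wedge (- a) b = - wedge a b.
Proof. by rewrite -scaleN1r wedgeZl scaleN1r. Qed.

Lemma wedgeNr a b : wedge a (- b) = - wedge a b.
Proof. by rewrite -scaleN1r wedgeZr scaleN1r. Qed.

Lemma parity_wedge a b : parity (wedge a b) = wedge (parity a) (parity b).
Proof.
apply/funext => s; elim: s a b => [|v s IH] a b.
  by rewrite /parity !wedge_nil /= !mul1r.
rewrite -/(contract v _ s) contract_parity contract_wedge linearD /= opprD.
rewrite wedge_cons cformD !cformN !IH contract_parity parityK wedgeNl.
by rewrite contract_parity wedgeNr.
Qed.

Lemma wedgeA : associative (@wedge R g).
Proof.
move=> a b c; apply/funext => s; elim: s a b c => [|v s IH] a b c.
  by rewrite !wedge_nil mulrA.
rewrite !wedge_cons !contract_wedge wedgeDl wedgeDr parity_wedge.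
by rewrite !cformD !IH addrA.
Qed.

Lemma contract1 v : contract v (@form1 R g) = 0.
Proof. by []. Qed.

Lemma parity1 : parity (@form1 R g) = @form1 R g.
Proof. by apply/funext=> -[|v s]; rewrite /parity ?mul1r ?mulr0. Qed.

Lemma wedge1l : left_id (@form1 R g) (@wedge R g).
Proof.
move=> a; apply/funext => s; elim: s a => [|v s IH] a.
  by rewrite wedge_nil mul1r.
by rewrite wedge_cons contract1 wedge0l add0r parity1 IH.
Qed.

Lemma wedge1r : right_id (@form1 R g) (@wedge R g).
Proof.
move=> a; apply/funext => s; elim: s a => [|v s IH] a.
  by rewrite wedge_nil mulr1.
by rewrite wedge_cons contract1 wedge0r addr0 IH.
Qed.

Lemma form1_neq0 : @form1 R g != 0.
Proof.
apply/eqP => /(congr1 (fun a : cform g => a [::])) /eqP.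
by rewrite cform0 oner_eq0.
Qed.

HB.instance Definition _ := GRing.Zmodule_isNzRing.Build (cform g)
  wedgeA wedge1l wedge1r wedgeDl wedgeDr form1_neq0.
HB.instance Definition _ :=
  GRing.Lmodule_isLalgebra.Build R[i] (cform g) (fun z a b => esym (wedgeZl z a b)).
HB.instance Definition _ :=
  GRing.Lalgebra_isAlgebra.Build R[i] (cform g) (fun z a b => esym (wedgeZr z a b)).

Lemma wedgeE a b : wedge a b = a * b. Proof. by []. Qed.

Lemma wedge_powE a (k : nat) : wedge_pow a k = a ^+ k.
Proof. by elim: k => [|k IH] //=; rewrite exprS -IH. Qed.

Lemma mul_nil a b : (a * b) [::] = a [::] * b [::].
Proof. exact: wedge_nil. Qed.

Lemma mul_cons a b v s :
  (a * b) (v :: s) = (contract v a * b) s + (parity a * contract v b) s.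
Proof. exact: wedge_cons. Qed.

Lemma contractM v a b :
  contract v (a * b) = contract v a * b + parity a * contract v b.
Proof. exact: contract_wedge. Qed.

Lemma parityM a b : parity (a * b) = parity a * parity b.
Proof. exact: parity_wedge. Qed.

(** Contraction exchanges even and odd forms, so the two cases feed each other in one induction on
    the arguments. *)
Lemma parity_comm a b :
  (parity a = a -> a * b = b * a) /\ (parity a = - a -> a * b = parity b * a).
Proof.
suff H s : (forall a b, parity a = a -> (a * b) s = (b * a) s) /\
           (forall a b, parity a = - a -> (a * b) s = (parity b * a) s).
  by split=> pa; apply/funext => s; have [H1 H2] := H s; [apply: H1|apply: H2].
elim: s => [|v s [IHe IHo]].
  split=> {}a {}b pa; rewrite -!wedgeE !wedge_nil mulrC //.
  by rewrite /parity /= mul1r.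
split=> {}a {}b pa; rewrite !mul_cons.
- have pca : parity (contract v a) = - contract v a.
    by rewrite -{2}pa contract_parity opprK.
  by rewrite pa (IHo _ b pca) (IHe _ (contract v b) pa) addrC.
have pca : parity (contract v a) = contract v a.
  by rewrite -[LHS]opprK -contract_parity pa linearN opprK.
rewrite (IHe _ b pca) pa mulNr cformN (IHo _ (contract v b) pa).
by rewrite parityK contract_parity mulNr cformN addrC.
Qed.

Lemma even_comm a b : parity a = a -> a * b = b * a.
Proof. by have [] := parity_comm a b. Qed.

Lemma odd_comm a b : parity a = - a -> a * b = parity b * a.
Proof. by have [] := parity_comm a b. Qed.

Definition homog (k : nat) a := forall s, size s != k -> a s = 0.

Lemma homog_parity k a : homog k a -> parity a = (-1) ^+ k *: a.
Proof.
move=> ha; apply/funext=> s; rewrite cformZ /parity.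
by have [<-//|/ha ->] := eqVneq (size s) k; rewrite !mulr0.
Qed.

Lemma homog_contract k v a : homog k a -> homog k.-1 (contract v a).
Proof.
by move=> ha s sk; apply: ha; case: k sk => [|k] //= sk; rewrite eqSS.
Qed.

Lemma homog0_contract v a : homog 0 a -> contract v a = 0.
Proof. by move=> ha; apply/funext => s; rewrite /contract ha. Qed.

Lemma homogD k a b : homog k a -> homog k b -> homog k (a + b).
Proof. by move=> ha hb s sk; rewrite cformD ha ?hb ?addr0. Qed.

Lemma homogZ k z a : homog k a -> homog k (z *: a).
Proof. by move=> ha s sk; rewrite cformZ ha ?mulr0. Qed.

Lemma homog1 : homog 0 1. Proof. by case. Qed.

Lemma homogM k l a b : homog k a -> homog l b -> homog (k + l) (a * b).
Proof.
move=> ha hb s; elim: s k l a b ha hb => [|v s IH] k l a b ha hb.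
  rewrite /= -wedgeE wedge_nil; case: k l ha hb => [|k] [|l] ha hb //= _.
  - by rewrite hb // mulr0.
  - by rewrite ha // mul0r.
  - by rewrite ha // mul0r.
move=> sk; rewrite mul_cons.
have -> : (contract v a * b) s = 0.
  case: k ha sk => [|k] ha sk; first by rewrite homog0_contract // mul0r.
  by apply: (IH k l) => //; apply: (@homog_contract k.+1).
rewrite add0r (homog_parity ha) -scalerAl cformZ.
case: l hb sk => [|l] hb sk; first by rewrite (homog0_contract v) // mulr0 cform0 mulr0.
rewrite (IH k l) ?mulr0 //; first exact: (@homog_contract l.+1).
by move: sk; rewrite addnS.
Qed.

Lemma homogX k a m : homog k a -> homog (k * m) (a ^+ m).
Proof.
move=> ha; elim: m => [|m IH]; first by rewrite muln0; apply: homog1.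
by rewrite exprS mulnS; apply: homogM.
Qed.

(* No degree is imposed, so that both predicates are stable under contraction. *)
Definition mlin a := forall s1 s2 (z : R) u v,
  a (s1 ++ (z *: u + v) :: s2) = (z%:C)%C * a (s1 ++ u :: s2) + a (s1 ++ v :: s2).

Definition altern a := mlin a /\ forall s1 s2 u, a (s1 ++ u :: u :: s2) = 0.

Lemma mlin_contract v a : mlin a -> mlin (contract v a).
Proof. by move=> la s1 s2 z u w; apply: (la (v :: s1)). Qed.

Lemma mlin0 : mlin 0. Proof. by move=> *; rewrite !cform0 mulr0 addr0. Qed.

Lemma mlinD a b : mlin a -> mlin b -> mlin (a + b).
Proof. by move=> la lb s1 s2 z u v; rewrite !cformD la lb; ring. Qed.

Lemma mlinZ z a : mlin a -> mlin (z *: a).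
Proof. by move=> la s1 s2 y u v; rewrite !cformZ la; ring. Qed.

Lemma mlin_head a (z : R) u v : mlin a ->
  contract (z *: u + v) a = (z%:C)%C *: contract u a + contract v a.
Proof. by move=> la; apply/funext=> s; apply: (la [::]). Qed.

Lemma mlin_headD a u v : mlin a -> contract (u + v) a = contract u a + contract v a.
Proof. by move=> la; rewrite -{1}[u]scale1r mlin_head // scale1r. Qed.

Lemma mlin_head0 a : mlin a -> contract 0 a = 0.
Proof. by move=> la; apply: (addIr (contract 0 a)); rewrite -mlin_headD // addr0 add0r. Qed.

Lemma mlin_headZ a (z : R) u : mlin a -> contract (z *: u) a = (z%:C)%C *: contract u a.
Proof. by move=> la; rewrite -[z *: u]addr0 mlin_head // mlin_head0 // addr0. Qed.

Lemma mlin_headN a u : mlin a -> contract (- u) a = - contract u a.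
Proof. by move=> la; apply/eqP; rewrite -addr_eq0 -mlin_headD // addNr mlin_head0. Qed.

Lemma mlin_parity a : mlin a -> mlin (parity a).
Proof.
by move=> la s1 s2 z u v; rewrite /parity la !size_cat /=; ring.
Qed.

Lemma mlinM a b : mlin a -> mlin b -> mlin (a * b).
Proof.
move=> la lb s1; elim: s1 a b la lb => [|x s1 IH] a b la lb s2 z u v /=.
  rewrite !mul_cons !mlin_head // mulrDl mulrDr -scalerAl -scalerAr.
  by rewrite !cformD !cformZ; ring.
rewrite !mul_cons !IH //; try exact: mlin_contract; try exact: mlin_parity.
by ring.
Qed.

Lemma altern_contract v a : altern a -> altern (contract v a).
Proof.
by move=> [la aa]; split; [apply: mlin_contract|move=> s1; apply: (aa (v :: s1))].
Qed.

Lemma altern_parity a : altern a -> altern (parity a).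
Proof.
move=> [la aa]; split; first exact: mlin_parity.
by move=> s1 s2 u; rewrite /parity aa mulr0.
Qed.

Lemma altern0 : altern 0. Proof. by split; [apply: mlin0|]. Qed.

Lemma alternD a b : altern a -> altern b -> altern (a + b).
Proof.
move=> [la aa] [lb ab]; split; first exact: mlinD.
by move=> s1 s2 u; rewrite cformD aa ab addr0.
Qed.

Lemma alternZ z a : altern a -> altern (z *: a).
Proof.
move=> [la aa]; split; first exact: mlinZ.
by move=> s1 s2 u; rewrite cformZ aa mulr0.
Qed.

Lemma altern_contract2 v a : altern a -> contract v (contract v a) = 0.
Proof. by move=> [_ aa]; apply/funext => s; apply: (aa [::]). Qed.

Lemma altern_contractC u v a : altern a ->
  contract u (contract v a) = - contract v (contract u a).
Proof.
move=> aa; apply/eqP; rewrite -addr_eq0.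
have la := aa.1; have := altern_contract2 (u + v) aa.
rewrite !mlin_headD //; last by apply: mlinD; apply: mlin_contract.
rewrite !linearD /= !altern_contract2 // add0r addr0 => H.
by apply/eqP.
Qed.

Lemma alternM a b : altern a -> altern b -> altern (a * b).
Proof.
move=> aa ab; split; first by apply: mlinM; [case: aa|case: ab].
move=> s1; elim: s1 a b aa ab => [|x s1 IH] a b aa ab s2 u /=.
  (* Contracting twice with [u] leaves two mixed terms in i_u a and i_u b, with opposite signs. *)
  rewrite !mul_cons !contract_parity parityK !altern_contract2 //.
  by rewrite mulr0 mul0r !cform0 mulNr cformN addr0 add0r subrr.
rewrite !mul_cons !IH ?addr0 //; try exact: altern_contract.
exact: altern_parity.
Qed.

Lemma altern1 : altern 1.
Proof. by split=> [[|? ?]|[|? ?]] * //=; rewrite mulr0 addr0. Qed.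

Lemma alternX a k : altern a -> altern (a ^+ k).
Proof.
move=> aa; elim: k => [|k IH]; first exact: altern1.
by rewrite exprS; apply: alternM.
Qed.

Lemma altern_swap a s1 s2 u v : altern a ->
  a (s1 ++ u :: v :: s2) = - a (s1 ++ v :: u :: s2).
Proof.
elim: s1 a => [|x s1 IH] a aa /=; last exact: (IH _ (altern_contract x aa)).
exact: (congr1 (fun b : cform g => b s2) (altern_contractC v u aa)).
Qed.

Lemma altern_move a s1 s2 s3 u : altern a ->
  a (s1 ++ s2 ++ u :: s3) = (-1) ^+ size s2 * a (s1 ++ u :: s2 ++ s3).
Proof.
move=> aa; elim: s2 s1 => [|x s2 IH] s1 /=; first by rewrite mul1r.
rewrite -cat_rcons IH cat_rcons altern_swap // exprS; ring.
Qed.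

Lemma altern_uniq a s : altern a -> ~~ uniq s -> a s = 0.
Proof.
move=> aa; elim: s a aa => [|x s IH] a aa //=.
rewrite negb_and negbK => /orP[|us]; last exact: (IH _ (altern_contract x aa)).
case/splitPr=> s1 s2; rewrite -[x :: _]/([:: x] ++ _) altern_move //=.
by rewrite (aa.2 [::]) mulr0.
Qed.

Lemma is_formP k a : is_form k a <-> altern a /\ homog k a.
Proof.
split=> [[ha ua la]|[[la aa] ha]]; split => //.
  split=> // s1 s2 u; apply: ua.
  by rewrite cat_uniq /= inE eqxx /= !andbF.
by move=> s; apply: altern_uniq.
Qed.

(** The induction keeps a t = a s up to an undetermined sign, which is enough to transport
    vanishing. *)
Lemma altern_perm0 a s t : altern a -> perm_eq s t -> a s = 0 -> a t = 0.
Proof.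
move=> aa st; suff: a t = a s \/ a t = - a s.
  by case=> -> -> //; rewrite oppr0.
elim: s t a aa st => [|x s IH] t a aa st.
  by left; move: st; rewrite perm_sym => /perm_nilP ->.
have xt : x \in t by rewrite -(perm_mem st) mem_head.
case/splitPr: xt st => t1 t2.
rewrite perm_sym perm_catC /= perm_cons perm_catC perm_sym => st.
rewrite -[t1 ++ _]/([::] ++ t1 ++ _) altern_move //= -signr_odd.
by have [] := IH _ _ (altern_contract x aa) st; rewrite /contract => ->;
  case: odd; rewrite ?mulN1r ?mul1r ?opprK; auto.
Qed.

End Algebra.

(** * The Chevalley-Eilenberg differential *)

Section Differential.
Variables (R : realType) (g : lieAlgebra R).
Implicit Types (f a b c : cform g) (s t : seq g) (u v x : g) (z : R[i]).

Lemma lie_add_l u v x : lie[u + v, x] = lie[u, x] + lie[v, x].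
Proof. by have := lie_linear_l x 1 u v; rewrite /= !scale1r. Qed.

Lemma lie_sym u v : lie[u, v] = - lie[v, u].
Proof.
apply/eqP; rewrite -addr_eq0; have := lie_alternating (u + v).
by rewrite lie_add_l !linearD /= !lie_alternating add0r addr0 => ->.
Qed.

Lemma lie_opp_l u v : lie[- u, v] = - lie[u, v].
Proof.
apply/eqP; rewrite -addr_eq0 -lie_add_l addNr.
by have := lie_linear_l v 1 0 0; rewrite /= !scale1r addr0 => /eqP;
  rewrite -subr_eq0 opprD addrA subrr sub0r oppr_eq0.
Qed.

(** The Lie derivative along the left-invariant field of [v], defined by i_u L_v = L_v i_u - i_[v,u]
    and by zero on scalars. In this form it is a derivation of the product of arbitrary functions on
    sequences. *)
Fixpoint lie_der_rec v f s : R[i] :=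
  if s is u :: s' then lie_der_rec v (contract u f) s' - f (lie[v, u] :: s')
  else 0.

Definition lie_der v f : cform g := lie_der_rec v f.
Arguments lie_der : simpl never.

Lemma lie_der_cons v f u s :
  lie_der v f (u :: s) = lie_der v (contract u f) s - contract lie[v, u] f s.
Proof. by []. Qed.

Lemma contract_lie_der u v f :
  contract u (lie_der v f) = lie_der v (contract u f) - contract lie[v, u] f.
Proof. by []. Qed.

Lemma lie_der_is_linear v : linear (lie_der v).
Proof.
move=> z a b; apply/funext => s; elim: s a b => [|u s IH] a b.
  by rewrite cformD cformZ /= mulr0 addr0.
rewrite cformD cformZ !lie_der_cons !contract_is_linear IH.
by rewrite !(cformD, cformZ); ring.
Qed.
HB.instance Definition _ v :=
  GRing.isLinear.Build R[i] (cform g) (cform g) *:%R (lie_der v)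
    (lie_der_is_linear v).

Lemma lie_der_parity v f : lie_der v (parity f) = parity (lie_der v f).
Proof.
apply/funext=> s; elim: s f => [|u s IH] f; first by rewrite /parity mulr0.
rewrite lie_der_cons !contract_parity linearN /= !cformN IH.
rewrite -[RHS]/(contract u (parity (lie_der v f)) s) contract_parity.
by rewrite contract_lie_der linearB /= opprB cformD cformN addrC opprK.
Qed.

Lemma lie_derM v a b : lie_der v (a * b) = lie_der v a * b + a * lie_der v b.
Proof.
apply/funext=> s; elim: s a b => [|u s IH] a b.
  by rewrite cformD !mul_nil mul0r mulr0 addr0.
rewrite lie_der_cons cformD !mul_cons !contract_lie_der !contractM linearD /=.
rewrite !cformD !IH lie_der_parity !mulrDl !mulrDr !mulNr !mulrN.
by rewrite !(cformD, cformN); ring.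
Qed.

Lemma lie_der_headl (k : R) u v f : mlin f ->
  lie_der (k *: u + v) f = (k%:C)%C *: lie_der u f + lie_der v f.
Proof.
move=> lf; apply/funext => s; elim: s f lf => [|x s IH] f lf.
  by rewrite cformD cformZ /= mulr0 addr0.
rewrite lie_der_cons IH; last exact: mlin_contract.
rewrite lie_linear_l mlin_head // !(cformD, cformZ) !lie_der_cons.
by rewrite /contract; ring.
Qed.

Lemma mlin_lie_der v f : mlin f -> mlin (lie_der v f).
Proof.
move=> lf s1; elim: s1 f lf => [|x s1 IH] f lf s2 k u w /=.
  rewrite !lie_der_cons mlin_head // !linearP /= mlin_head //.
  by rewrite !(cformD, cformZ); ring.
rewrite !lie_der_cons IH; last exact: mlin_contract.
by rewrite (mlin_contract _ lf); ring.
Qed.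

Lemma altern_lie_der v f : altern f -> altern (lie_der v f).
Proof.
move=> af; split; first by apply: mlin_lie_der; case: af.
move=> s1; elim: s1 f af => [|x s1 IH] f af s2 u /=.
  rewrite [LHS]lie_der_cons lie_der_cons altern_contract2 // linear0 cform0 sub0r.
  have /(congr1 (fun b : cform g => b s2)) := altern_contractC u lie[v, u] af.
  rewrite cformN => H.
  by rewrite -[contract _ f (_ :: _)]/(contract u (contract lie[v, u] f) s2) H opprK addNr.
rewrite !lie_der_cons IH; last exact: altern_contract.
by rewrite (altern_contract _ af).2 subrr.
Qed.

Lemma homog_lie_der k v f : homog k f -> homog k (lie_der v f).
Proof.
move=> hf s; elim: s k f hf => [|u s IH] k f hf sk //.
rewrite lie_der_cons [contract _ _ _]hf // subr0.
case: k hf sk => [|k] hf sk; first by rewrite homog0_contract // linear0.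
by rewrite (IH k) //; apply: (@homog_contract _ _ k.+1).
Qed.

Lemma lie_derE v f s :
  lie_der v f s = - \sum_(j < size s) f (take j s ++ lie[v, s`_j] :: drop j.+1 s).
Proof.
elim: s f => [|u s IH] f; first by rewrite big_ord0 oppr0.
by rewrite lie_der_cons IH big_ord_recl /= drop0 opprD addrC.
Qed.

Lemma omit1E s j : (j < size s)%N ->
  [seq s`_k | k <- iota 0 (size s) & k != j] = take j s ++ drop j.+1 s.
Proof.
elim: s j => [|x s IH] [|j] //= js.
  rewrite drop0 (@eq_in_filter _ _ predT) ?filter_predT; last first.
    by case=> //; rewrite mem_iota.
  by rewrite -[1%N]addn0 iotaDl -map_comp; exact: mkseq_nth.
rewrite -IH //; congr (_ :: _).
by rewrite -[1%N]addn0 iotaDl filter_map -map_comp; congr map; apply: eq_filter.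
Qed.

Lemma omit2_0 v s j : (j < size s)%N ->
  omit2 (v :: s) 0 j.+1 = take j s ++ drop j.+1 s.
Proof.
move=> js; rewrite -omit1E // /omit2 /= -[1%N]addn0 iotaDl filter_map -map_comp.
by congr map; apply: eq_filter.
Qed.

Lemma omit2_S v s i j : omit2 (v :: s) i.+1 j.+1 = v :: omit2 s i j.
Proof.
rewrite /omit2 /=; congr (_ :: _).
rewrite -[1%N]addn0 iotaDl filter_map -map_comp.
by congr map; apply: eq_filter.
Qed.

Lemma dform_nil f : dform f [::] = 0. Proof. by rewrite /dform big_ord0. Qed.

Lemma dform_is_linear : linear (@dform R g).
Proof.
move=> z a b; apply/funext => s; rewrite cformD cformZ /dform mulr_sumr -big_split.
apply: eq_bigr => i _; rewrite mulr_sumr -big_split; apply: eq_bigr => j _ /=.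
by rewrite cformD cformZ; ring.
Qed.
HB.instance Definition _ :=
  GRing.isLinear.Build R[i] (cform g) (cform g) *:%R (@dform R g) dform_is_linear.

Lemma dform0 : dform (0 : cform g) = 0. Proof. exact: linear0. Qed.
Lemma dformD a b : dform (a + b) = dform a + dform b. Proof. exact: linearD. Qed.
Lemma dformN a : dform (- a) = - dform a. Proof. exact: linearN. Qed.
Lemma dformZ z a : dform (z *: a) = z *: dform a. Proof. exact: linearZ. Qed.

(* Cartan's formula [i_v d = L_v - d i_v]. *)
Lemma dform_cons f v s : altern f ->
  dform f (v :: s) = lie_der v f s - dform (contract v f) s.
Proof.
move=> af; rewrite {1}/dform big_ord_recl; congr (_ + _).
  (* Pairs with i = 0: the bracket of [v] with the entry j of [s] moves past j entries, whence the
     sign (-1)^j, and the sum is L_v. *)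
  rewrite big_mkcond big_ord_recl /= add0r lie_derE -sumrN.
  apply: eq_bigr => j _; rewrite omit2_0 // -[take j s ++ _ :: _]/([::] ++ take j s ++ _ :: _).
  by rewrite altern_move //= size_take ltn_ord /= /bump /= add1n exprS; ring.
(* Pairs without [v]: exchanging [v] with the bracket gives minus the differential of the
   contraction. *)
rewrite /dform -sumrN; apply: eq_bigr => i _.
rewrite big_mkcond big_ord_recl /= add0r -big_mkcond /= -sumrN; apply: eq_bigr => j _.
rewrite /bump !add1n omit2_S /= -[_ :: _ :: _]/([::] ++ _ :: _ :: _) altern_swap //.
by rewrite /contract /= addSn addnS !exprS; ring.
Qed.

Lemma contract_dform v f : altern f ->
  contract v (dform f) = lie_der v f - dform (contract v f).
Proof. by move=> af; apply/funext => s; apply: dform_cons. Qed.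

Lemma homog_dform k f : altern f -> homog k f -> homog k.+1 (dform f).
Proof.
move=> af hf s; elim: s k f af hf => [|v s IH] k f af hf sk; first exact: dform_nil.
rewrite dform_cons // (homog_lie_der _ hf) // sub0r.
case: k hf sk => [|k] hf sk; first by rewrite homog0_contract // linear0 oppr0.
rewrite (IH k) ?oppr0 //; first exact: altern_contract.
exact: (@homog_contract _ _ k.+1).
Qed.

Lemma altern_dform f : altern f -> altern (dform f).
Proof.
move=> af; split=> s1; elim: s1 f af => [|x s1 IH] f af s2.
- move=> k u v /=; have lf := af.1; rewrite !dform_cons //.
  rewrite lie_der_headl // mlin_head // linearP /= !(cformD, cformZ); ring.
- move=> k u v /=; rewrite !dform_cons // (altern_lie_der x af).1.
  by rewrite IH; [ring | apply: altern_contract].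
(* Both Cartan expansions produce L_u i_u f, which cancels; what is left involves [u, u] and i_u i_u
   f. *)
- move=> u /=; rewrite dform_cons // lie_der_cons dform_cons; last exact: altern_contract.
  rewrite lie_alternating mlin_head0; last by case: af.
  by rewrite altern_contract2 // dform0 !cform0 !subr0 subrr.
- move=> u /=; rewrite dform_cons // (altern_lie_der x af).2.
  by rewrite IH ?subr0 //; apply: altern_contract.
Qed.

Lemma dform_parity f : altern f -> dform (parity f) = - parity (dform f).
Proof.
move=> af; apply/funext => s; elim: s f af => [|v s IH] f af.
  by rewrite cformN /parity !dform_nil mulr0 oppr0.
rewrite dform_cons; last exact: altern_parity.
rewrite lie_der_parity contract_parity dformN !cformN IH; last exact: altern_contract.
rewrite -[parity (dform f) _]/(contract v (parity (dform f)) s).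
rewrite contract_parity cformN opprK contract_dform //.
by rewrite (linearB (@parity R g)) /= !cformN opprK.
Qed.

Lemma dformM a b : altern a -> altern b ->
  dform (a * b) = dform a * b + parity a * dform b.
Proof.
move=> aa ab; apply/funext => s; elim: s a b aa ab => [|v s IH] a b aa ab.
  rewrite cformD !mul_nil !dform_nil mul0r mulr0 addr0 //.
rewrite dform_cons; last exact: alternM.
have [ca cb] := (altern_contract v aa, altern_contract v ab).
rewrite lie_derM contractM dformD !cformD (IH _ _ ca ab).
rewrite (IH _ _ (altern_parity aa) cb) !cformD.
rewrite !mul_cons !contract_dform // contract_parity parityK.
rewrite dform_parity // !mulrDr !mulrDl.
rewrite !(cformD, mulNr, mulrN, cformN).
by ring.
Qed.

End Differential.

(** * Type components *)

Section Types.
Variables (R : realType) (g : lieAlgebra R) (J : 'End(g)).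
Implicit Types (f a b c : cform g) (s t : seq g) (u v x : g) (z : R[i]).
Implicit Types (p q r l : int).

Definition contract10 v f : cform g :=
  2^-1 *: (contract v f - 'i%C *: contract (J v) f).
Definition contract01 v f : cform g :=
  2^-1 *: (contract v f + 'i%C *: contract (J v) f).

(* Integer indices make the recursion uniform: the component vanishes as soon
   as one index is negative. *)
Fixpoint type_comp_rec p q f s : R[i] :=
  if s is v :: s' then
    type_comp_rec (p - 1) q (contract10 v f) s'
    + type_comp_rec p (q - 1) (contract01 v f) s'
  else if (p == 0) && (q == 0) then f [::] else 0.

Definition type_comp p q f : cform g := type_comp_rec p q f.
Arguments type_comp : simpl never.

Lemma type_comp_cons p q f v s : type_comp p q f (v :: s)
  = type_comp (p - 1) q (contract10 v f) s + type_comp p (q - 1) (contract01 v f) s.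
Proof. by []. Qed.

Lemma contract_type_comp p q f v : contract v (type_comp p q f)
  = type_comp (p - 1) q (contract10 v f) + type_comp p (q - 1) (contract01 v f).
Proof. by []. Qed.

Lemma type_comp_homog p q f s : (size s)%:Z != p + q -> type_comp p q f s = 0.
Proof.
elim: s p q f => [|v s IH] p q f.
  rewrite /type_comp /=; case: ifP => // /andP[/eqP-> /eqP->].
  by rewrite addr0 eqxx.
move=> sz; rewrite type_comp_cons !IH ?addr0 //; move: sz; apply: contra => /eqP sz /=;
  by rewrite -addn1 PoszD sz; apply/eqP; ring.
Qed.

Lemma type_comp_lt0 p q f : (p < 0) || (q < 0) -> type_comp p q f = 0.
Proof.
move=> pq; apply/funext => s; elim: s p q f pq => [|v s IH] p q f pq.
  rewrite /type_comp /=; case: ifP => // /andP[/eqP p0 /eqP q0].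
  by move: pq; rewrite p0 q0 ltxx.
rewrite type_comp_cons !IH ?addr0 //.
  by move: pq; lia.
by move: pq; lia.
Qed.

Lemma type_compE (p q : nat) f : type_part J p q f = type_comp p q f.
Proof.
apply/funext => s; elim: s p q f => [|v s IH] p q f //.
rewrite type_comp_cons /type_part /=; congr (_ + _).
- case: p => [|p]; first by rewrite type_comp_lt0.
  have -> : p.+1%:Z - 1 = p by lia.
  rewrite -/(type_part J p q _ s) IH; congr (type_comp _ _ _ _).
  by apply/funext => t; rewrite /contract10 cformZ mulrC.
- case: q => [|q]; first by rewrite type_comp_lt0 // orbT.
  have -> : q.+1%:Z - 1 = q by lia.
  rewrite -/(type_part J p q _ s) IH; congr (type_comp _ _ _ _).
  by apply/funext => t; rewrite /contract01 cformZ mulrC.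
Qed.

Lemma contract10_is_linear v : linear (contract10 v).
Proof.
move=> z a b; apply/funext=> s.
by rewrite /contract10 !contract_is_linear !(cformZ, cformD, cformN); ring.
Qed.
Lemma contract01_is_linear v : linear (contract01 v).
Proof.
move=> z a b; apply/funext=> s.
by rewrite /contract01 !contract_is_linear !(cformZ, cformD, cformN); ring.
Qed.

Lemma contract10M v a b :
  contract10 v (a * b) = contract10 v a * b + parity a * contract10 v b.
Proof.
rewrite /contract10 !contractM -scalerAl -scalerAr -scalerDr; congr (_ *: _).
by rewrite mulrBl mulrBr -scalerAl -scalerAr scalerDr opprD addrACA.
Qed.
Lemma contract01M v a b :
  contract01 v (a * b) = contract01 v a * b + parity a * contract01 v b.
Proof.
rewrite /contract01 !contractM -scalerAl -scalerAr -scalerDr; congr (_ *: _).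
by rewrite mulrDl mulrDr -scalerAl -scalerAr scalerDr addrACA.
Qed.

Lemma contract_split v f : contract v f = contract10 v f + contract01 v f.
Proof.
apply/funext=> s.
by rewrite /contract10 /contract01 !(cformD, cformZ, cformN); field.
Qed.

Lemma mlin_contract10 v f : mlin f -> mlin (contract10 v f).
Proof.
move=> lf; rewrite /contract10 -scaleN1r.
by apply/mlinZ/mlinD; do ?apply: mlinZ; apply: mlin_contract.
Qed.
Lemma mlin_contract01 v f : mlin f -> mlin (contract01 v f).
Proof.
by move=> lf; apply/mlinZ/mlinD; do ?apply: mlinZ; apply: mlin_contract.
Qed.

Lemma altern_contract10 v f : altern f -> altern (contract10 v f).
Proof.
move=> lf; rewrite /contract10 -scaleN1r.
by apply/alternZ/alternD; do ?apply: alternZ; apply: altern_contract.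
Qed.
Lemma altern_contract01 v f : altern f -> altern (contract01 v f).
Proof.
by move=> lf; apply/alternZ/alternD; do ?apply: alternZ; apply: altern_contract.
Qed.

Lemma contract10_parity v f : contract10 v (parity f) = - parity (contract10 v f).
Proof.
rewrite /contract10 !contract_parity parityZ parityD parityN.
by rewrite parityZ; apply/funext=> s; rewrite !(cformZ, cformD, cformN); ring.
Qed.
Lemma contract01_parity v f : contract01 v (parity f) = - parity (contract01 v f).
Proof.
rewrite /contract01 !contract_parity parityZ parityD.
by rewrite parityZ /= -scalerN opprD scalerN.
Qed.

Lemma type_comp_is_linear p q : linear (type_comp p q).
Proof.
move=> z a b; apply/funext=> s; elim: s p q a b => [|v s IH] p q a b.
  rewrite cformD cformZ /type_comp /=; case: ifP => // _.
  by rewrite mulr0 addr0.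
rewrite cformD cformZ !type_comp_cons contract10_is_linear contract01_is_linear.
by rewrite !IH !cformD !cformZ; ring.
Qed.
HB.instance Definition _ p q :=
  GRing.isLinear.Build R[i] (cform g) (cform g) *:%R (type_comp p q)
    (type_comp_is_linear p q).

Lemma type_comp0 p q : type_comp p q 0 = 0. Proof. exact: linear0. Qed.
Lemma type_compN p q a : type_comp p q (- a) = - type_comp p q a.
Proof. exact: linearN. Qed.
Lemma type_compD p q a b : type_comp p q (a + b) = type_comp p q a + type_comp p q b.
Proof. exact: linearD. Qed.
Lemma type_compZ p q z a : type_comp p q (z *: a) = z *: type_comp p q a.
Proof. exact: linearZ. Qed.

Lemma type_comp_parity p q f : type_comp p q (parity f) = parity (type_comp p q f).
Proof.
apply/funext=> s; elim: s p q f => [|v s IH] p q f.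
  by rewrite /parity /type_comp /=; case: ifP; rewrite ?mulr0.
rewrite type_comp_cons contract10_parity contract01_parity.
rewrite !type_compN !cformN !IH.
rewrite -[RHS]/(contract v (parity (type_comp p q f)) s) contract_parity.
by rewrite contract_type_comp parityD /= opprD.
Qed.

Lemma contract10_headD v (k : R) u f : mlin f ->
  contract10 (k *: u + v) f = (k%:C)%C *: contract10 u f + contract10 v f.
Proof.
move=> lf; apply/funext=> s; rewrite /contract10 linearP !mlin_head //.
by rewrite !(cformD, cformZ, cformN); ring.
Qed.
Lemma contract01_headD v (k : R) u f : mlin f ->
  contract01 (k *: u + v) f = (k%:C)%C *: contract01 u f + contract01 v f.
Proof.
move=> lf; apply/funext=> s; rewrite /contract01 linearP !mlin_head //.
by rewrite !(cformD, cformZ, cformN); ring.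
Qed.

Lemma mlin_type_comp p q f : mlin f -> mlin (type_comp p q f).
Proof.
move=> lf s1; elim: s1 p q f lf => [|x s1 IH] p q f lf s2 k u v /=.
  rewrite !type_comp_cons contract10_headD // contract01_headD //.
  by rewrite !type_comp_is_linear !(cformD, cformZ); ring.
rewrite !type_comp_cons !IH; [ring|exact: mlin_contract01|exact: mlin_contract10].
Qed.

Lemma contractC10_10 v f : altern f -> contract10 v (contract10 v f) = 0.
Proof.
move=> af; rewrite /contract10 !contractZ !(contractD, contractN).
rewrite !contractZ !altern_contract2 // (altern_contractC v) //.
by apply/funext=> s; rewrite !(cformZ, cformD, cformN, cform0); ring.
Qed.
Lemma contractC01_01 v f : altern f -> contract01 v (contract01 v f) = 0.
Proof.
move=> af; rewrite /contract01 !contractZ !contractD.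
rewrite !contractZ !altern_contract2 // (altern_contractC v) //.
by apply/funext=> s; rewrite !(cformZ, cformD, cformN, cform0); ring.
Qed.
Lemma contractC01_10 v f : altern f ->
  contract01 v (contract10 v f) = - contract10 v (contract01 v f).
Proof.
move=> af; rewrite /contract01 /contract10.
rewrite !contractZ !(contractD, contractN).
rewrite !contractZ !altern_contract2 // (altern_contractC v) //.
by apply/funext=> s; rewrite !(cformZ, cformD, cformN, cform0); ring.
Qed.

Lemma altern_type_comp p q f : altern f -> altern (type_comp p q f).
Proof.
move=> af; split; first by apply: mlin_type_comp; case: af.
move=> s1; elim: s1 p q f af => [|x s1 IH] p q f af s2 u /=.
  rewrite !type_comp_cons contractC10_10 // contractC01_01 // contractC01_10 //.
  rewrite !type_comp0 type_compN cformN !cform0.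
  by rewrite add0r addr0 addNr.
rewrite !type_comp_cons !IH ?addr0 //; [exact: altern_contract01|exact: altern_contract10].
Qed.

Let ii2 : 'i%C * 'i%C = -1 :> R[i]. Proof. by rewrite -expr2 sqr_i. Qed.

Hypothesis JJ : forall x, J (J x) = - x.

Lemma contract10J v f : mlin f -> contract10 (J v) f = 'i%C *: contract10 v f.
Proof.
move=> lf; apply/funext=> s; rewrite /contract10 JJ mlin_headN //.
rewrite !(cformD, cformN, cformZ).
by ring: ii2.
Qed.
Lemma contract01J v f : mlin f -> contract01 (J v) f = - 'i%C *: contract01 v f.
Proof.
move=> lf; apply/funext=> s; rewrite /contract01 JJ mlin_headN //.
rewrite !(cformD, cformN, cformZ).
by ring: ii2.
Qed.

(** [J v] multiplies the (1,0) contraction by i and the (0,1) contraction by -i, so in v - i J v the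
    second one cancels. *)
Lemma contract10_type_comp p q v f : mlin f ->
  contract10 v (type_comp p q f) = type_comp (p - 1) q (contract10 v f).
Proof.
move=> lf; rewrite {1}/contract10 !contract_type_comp contract10J // contract01J //.
rewrite !type_compZ; apply/funext=> s.
by rewrite !(cformD, cformN, cformZ); field: ii2.
Qed.
Lemma contract01_type_comp p q v f : mlin f ->
  contract01 v (type_comp p q f) = type_comp p (q - 1) (contract01 v f).
Proof.
move=> lf; rewrite {1}/contract01 !contract_type_comp contract10J // contract01J //.
rewrite !type_compZ; apply/funext=> s.
by rewrite !(cformD, cformN, cformZ); field: ii2.
Qed.

Lemma type_comp_comp p q r l f : mlin f ->
  type_comp p q (type_comp r l f)
  = if (p == r) && (q == l) then type_comp r l f else 0.
Proof.
move=> lf; apply/funext=> s; elim: s p q r l f lf => [|v s IH] p q r l f lf.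
  rewrite /type_comp /=; case: (eqVneq p 0) => [->|p0] /=; last first.
    case: ifP => [/andP[/eqP <- _]|//]; rewrite /= ifN //.
    by rewrite negb_and p0.
  case: (eqVneq q 0) => [->|q0] /=; last first.
    case: ifP => [/andP[_ /eqP <-]|//]; rewrite /= ifN //.
    by rewrite negb_and q0 orbT.
  by rewrite ![0 == _]eq_sym; case: ifP => // H; rewrite /= H.
rewrite type_comp_cons contract10_type_comp // contract01_type_comp //.
rewrite !IH; [|exact: mlin_contract01|exact: mlin_contract10].
rewrite !(inj_eq (addIr _)); case: ifP => _ //=; by rewrite addr0.
Qed.

(** Only [b] has a pure type: in the Leibniz rules the other factor is a differential, with several
    components. *)
Lemma type_comp_mulr p q r l a b : mlin b -> type_comp r l b = b ->
  type_comp (p + r) (q + l) (a * b) = type_comp p q a * b.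
Proof.
move=> lb tb; apply/funext=> s; elim: s p q r l a b lb tb => [|v s IH] p q r l a b lb tb.
  rewrite mul_nil /type_comp /= mul_nil.
  have: b [::] = type_comp r l b [::] by rewrite tb.
  rewrite /type_comp /=; case: ifP => [/andP[/eqP -> /eqP ->] _| _ ->].
    by rewrite !addr0; case: ifP; rewrite ?mul0r.
  by rewrite !mulr0 if_same.
have t10 : type_comp (r - 1) l (contract10 v b) = contract10 v b.
  by rewrite -contract10_type_comp // tb.
have t01 : type_comp r (l - 1) (contract01 v b) = contract01 v b.
  by rewrite -contract01_type_comp // tb.
rewrite type_comp_cons contract10M contract01M !type_compD !cformD.
rewrite -!addrA (IH p q _ _ _ _ _ t10) ?(IH p q _ _ _ _ _ t01);
  [|exact: mlin_contract01|exact: mlin_contract10].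
rewrite (addrC r) (addrC l) !addrA (IH (p - 1) q r l _ b) ?(IH p (q - 1) r l _ b) //.
rewrite mul_cons contract_type_comp mulrDl cformD (contract_split v b) mulrDr cformD.
rewrite type_comp_parity; ring.
Qed.

Lemma type_comp_mull p q r l a b : mlin a -> type_comp r l a = a ->
  type_comp (r + p) (l + q) (a * b) = a * type_comp p q b.
Proof.
move=> la ta; apply/funext=> s; elim: s p q r l a b la ta => [|v s IH] p q r l a b la ta.
  rewrite mul_nil /type_comp /= mul_nil.
  have: a [::] = type_comp r l a [::] by rewrite ta.
  rewrite /type_comp /=; case: ifP => [/andP[/eqP -> /eqP ->] _| _ ->].
    by rewrite !add0r; case: ifP; rewrite ?mulr0.
  by rewrite !mul0r if_same.
have t10 : type_comp (r - 1) l (contract10 v a) = contract10 v a.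
  by rewrite -contract10_type_comp // ta.
have t01 : type_comp r (l - 1) (contract01 v a) = contract01 v a.
  by rewrite -contract01_type_comp // ta.
have tp : type_comp r l (parity a) = parity a by rewrite type_comp_parity ta.
rewrite type_comp_cons contract10M contract01M !type_compD !cformD.
rewrite -!addrA (IH (p - 1) q r l _ _ _ tp) ?(IH p (q - 1) r l _ _ _ tp) //;
  try exact: mlin_parity.
rewrite (addrC p) (addrC q) !addrA (IH _ _ _ _ _ b _ t10) ?(IH _ _ _ _ _ b _ t01);
  [|exact: mlin_contract01|exact: mlin_contract10].
rewrite mul_cons contract_type_comp (contract_split v a) mulrDl mulrDr !cformD.
by rewrite ![-1 + _]addrC; ring.
Qed.

Lemma is_pq_formP (p q : nat) f :
  is_pq_form J p q f <-> altern f /\ type_comp p q f = f.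
Proof.
rewrite /is_pq_form type_compE; split=> [[/is_formP[af hf] tf]|[af tf]] //.
split=> //; apply/is_formP; split=> // s sz; rewrite -tf type_comp_homog //.
Qed.

Lemma pq_form_mul (p q r l : nat) a b :
  is_pq_form J p q a -> is_pq_form J r l b -> is_pq_form J (p + r) (q + l) (a * b).
Proof.
move=> /is_pq_formP[aa ta] /is_pq_formP[ab tb]; apply/is_pq_formP.
split; first exact: alternM.
by rewrite !PoszD type_comp_mulr ?ta //; case: ab.
Qed.

Lemma pq_form1 : is_pq_form J 0 0 1.
Proof.
apply/is_pq_formP; split; first exact: altern1.
apply/funext=> -[|v s] //; rewrite type_comp_homog //.
Qed.

Lemma pq_formX (p q : nat) a k : is_pq_form J p q a -> is_pq_form J (k * p) (k * q) (a ^+ k).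
Proof.
move=> ta; elim: k => [|k IH]; first exact: pq_form1.
by rewrite exprS; apply: pq_form_mul.
Qed.

Lemma pq_formD (p q : nat) a b : is_pq_form J p q a -> is_pq_form J p q b ->
  is_pq_form J p q (a + b).
Proof.
move=> /is_pq_formP[aa ta] /is_pq_formP[ab tb]; apply/is_pq_formP.
by rewrite type_compD ta tb; split=> //; apply: alternD.
Qed.

Lemma pq_formZ (p q : nat) z a : is_pq_form J p q a -> is_pq_form J p q (z *: a).
Proof.
move=> /is_pq_formP[aa ta]; apply/is_pq_formP.
by rewrite type_compZ ta; split=> //; apply: alternZ.
Qed.

Lemma type_part_pq (p q p' q' : nat) f : is_pq_form J p q f ->
  type_part J p' q' f = if (p' == p) && (q' == q) then f else 0.
Proof.
by move=> /is_pq_formP[[lf _] <-]; rewrite type_compE type_comp_comp // !eqz_nat.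
Qed.

(** The other summands of [del] first project a form of pure type onto a different type, and
    vanish. *)
Lemma delE (p q : nat) f : is_pq_form J p q f ->
  del J f = type_comp p.+1 q (dform f).
Proof.
move=> pf; have [/is_formP[af hf] _] := pf; apply/funext=> s; rewrite /del.
have [sz|sz] := eqVneq (size s) (p + q).+1; last first.
  rewrite type_comp_homog; last by rewrite -PoszD eqz_nat addSn.
  apply: big1 => i _ /=; rewrite (type_part_pq _ _ pf) type_compE ifN.
    by rewrite dform0 type_comp0 cform0.
  by move: sz; case: i => i /=; lia.
have ip : (p < size s)%N by rewrite sz ltnS leq_addr.
rewrite (bigD1 (Ordinal ip)) //= big1 ?addr0 => [|i ni].
  rewrite (type_part_pq _ _ pf) type_compE.
  have -> : (size s - p.+1 = q)%N by lia.
  by rewrite !eqxx.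
rewrite (type_part_pq _ _ pf) type_compE ifN; last by rewrite negb_and ni.
by rewrite dform0 type_comp0 cform0.
Qed.

Lemma delbarE (p q : nat) f : is_pq_form J p q f ->
  delbar J f = type_comp p q.+1 (dform f).
Proof.
move=> pf; have [/is_formP[af hf] _] := pf; apply/funext=> s; rewrite /delbar.
have [sz|sz] := eqVneq (size s) (p + q).+1; last first.
  rewrite type_comp_homog; last by rewrite -PoszD eqz_nat addnS.
  apply: big1 => i _ /=; rewrite (type_part_pq _ _ pf) type_compE ifN.
    by rewrite dform0 type_comp0 cform0.
  by move: sz; case: i => i /=; lia.
have ip : (p < size s)%N by rewrite sz ltnS leq_addr.
rewrite (bigD1 (Ordinal ip)) //= big1 ?addr0 => [|i ni].
  rewrite (type_part_pq _ _ pf) type_compE.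
  have -> : (size s - p.+1 = q)%N by lia.
  by rewrite !eqxx.
rewrite (type_part_pq _ _ pf) type_compE ifN; last by rewrite negb_and ni.
by rewrite dform0 type_comp0 cform0.
Qed.

Lemma pq_form_type_comp (p q : nat) f : altern f -> is_pq_form J p q (type_comp p q f).
Proof.
move=> af; apply/is_pq_formP; split; first exact: altern_type_comp.
by rewrite type_comp_comp ?eqxx //; case: af.
Qed.

Lemma pq_form_del (p q : nat) f : is_pq_form J p q f -> is_pq_form J p.+1 q (del J f).
Proof.
move=> pf; rewrite (delE pf); apply: pq_form_type_comp; apply: altern_dform.
by case/is_pq_formP: pf.
Qed.

Lemma pq_form_delbar (p q : nat) f : is_pq_form J p q f -> is_pq_form J p q.+1 (delbar J f).
Proof.
move=> pf; rewrite (delbarE pf); apply: pq_form_type_comp; apply: altern_dform.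
by case/is_pq_formP: pf.
Qed.

Lemma delM (p q r l : nat) a b : is_pq_form J p q a -> is_pq_form J r l b ->
  del J (a * b) = del J a * b + parity a * del J b.
Proof.
move=> pa pb; have pab := pq_form_mul pa pb; rewrite (delE pab) (delE pa) (delE pb).
case/is_pq_formP: pa => aa ta; case/is_pq_formP: pb => ab tb.
rewrite dformM // type_compD; congr (_ + _).
  by rewrite -addSn !PoszD type_comp_mulr //; case: ab.
rewrite -addnS !PoszD type_comp_mull //; first by apply: mlin_parity; case: aa.
by rewrite type_comp_parity ta.
Qed.

Lemma delbarM (p q r l : nat) a b : is_pq_form J p q a -> is_pq_form J r l b ->
  delbar J (a * b) = delbar J a * b + parity a * delbar J b.
Proof.
move=> pa pb; have pab := pq_form_mul pa pb; rewrite (delbarE pab) (delbarE pa) (delbarE pb).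
case/is_pq_formP: pa => aa ta; case/is_pq_formP: pb => ab tb.
rewrite dformM // type_compD; congr (_ + _).
  by rewrite -addSn !PoszD type_comp_mulr //; case: ab.
rewrite -addnS !PoszD type_comp_mull //; first by apply: mlin_parity; case: aa.
by rewrite type_comp_parity ta.
Qed.

Lemma type_part_is_linear (p q : nat) : linear (@type_part R g J p q).
Proof. by move=> z a b; rewrite !type_compE type_comp_is_linear. Qed.

Lemma del_is_linear : linear (@del R g J).
Proof.
move=> z a b; apply/funext=> s; rewrite cformD cformZ /del mulr_sumr -big_split.
apply: eq_bigr => i _ /=.
by rewrite type_part_is_linear dform_is_linear type_part_is_linear cformD cformZ.
Qed.
HB.instance Definition _ :=
  GRing.isLinear.Build R[i] (cform g) (cform g) *:%R (@del R g J) del_is_linear.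

Lemma delbar_is_linear : linear (@delbar R g J).
Proof.
move=> z a b; apply/funext=> s; rewrite cformD cformZ /delbar mulr_sumr -big_split.
apply: eq_bigr => i _ /=.
by rewrite type_part_is_linear dform_is_linear type_part_is_linear cformD cformZ.
Qed.
HB.instance Definition _ :=
  GRing.isLinear.Build R[i] (cform g) (cform g) *:%R (@delbar R g J) delbar_is_linear.

Lemma delD a b : del J (a + b) = del J a + del J b. Proof. exact: linearD. Qed.
Lemma delZ z a : del J (z *: a) = z *: del J a. Proof. exact: linearZ. Qed.
Lemma del0 : del J 0 = 0. Proof. exact: linear0. Qed.
Lemma delbarD a b : delbar J (a + b) = delbar J a + delbar J b.
Proof. exact: linearD. Qed.
Lemma delbarZ z a : delbar J (z *: a) = z *: delbar J a. Proof. exact: linearZ. Qed.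
Lemma delbar0 : delbar J 0 = 0. Proof. exact: linear0. Qed.

End Types.
Arguments wedge_pow : simpl never.
Arguments type_comp {R g} J p q f : simpl never.

(** * Pullback along a Lie algebra morphism compatible with the complex structures *)

Section Pullback.
Variables (R : realType) (g h : lieAlgebra R) (pi : 'Hom(g, h)).
Implicit Types (f a b : cform h) (v : g) (s : seq g).

Lemma contract_pullback v f : contract v (pullback pi f) = pullback pi (contract (pi v) f).
Proof. by []. Qed.

Lemma pullback_is_linear : linear (@pullback R g h pi). Proof. by []. Qed.
HB.instance Definition _ :=
  GRing.isLinear.Build R[i] (cform h) (cform g) *:%R (@pullback R g h pi)
    pullback_is_linear.

Lemma pullback0 : pullback pi 0 = 0. Proof. by []. Qed.
Lemma pullbackZ z f : pullback pi (z *: f) = z *: pullback pi f. Proof. by []. Qed.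

Lemma pullback_parity f : pullback pi (parity f) = parity (pullback pi f).
Proof. by apply/funext=> s; rewrite /pullback /parity size_map. Qed.

Lemma pullbackM a b : pullback pi (a * b) = pullback pi a * pullback pi b.
Proof.
apply/funext=> s; elim: s a b => [|v s IH] a b.
  by rewrite /pullback /= !mul_nil.
by rewrite mul_cons !contract_pullback -pullback_parity -!IH /pullback /= mul_cons.
Qed.

Lemma pullback1 : pullback pi 1 = 1.
Proof. by apply/funext=> -[|v s]. Qed.

Lemma pullbackX a k : pullback pi (a ^+ k) = pullback pi a ^+ k.
Proof. by elim: k => [|k IH]; rewrite ?pullback1 // !exprS pullbackM IH. Qed.

Lemma pullback_wedge_pow a (k : int) : pullback pi (wedge_pow a k) = wedge_pow (pullback pi a) k.
Proof. by case: k => k //; rewrite !wedge_powE pullbackX. Qed.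

Lemma mlin_pullback f : mlin f -> mlin (pullback pi f).
Proof. by move=> lf s1 s2 k u v; rewrite /pullback !map_cat /= linearP lf. Qed.

Lemma altern_pullback f : altern f -> altern (pullback pi f).
Proof.
move=> [lf af]; split; first exact: mlin_pullback.
by move=> s1 s2 u; rewrite /pullback map_cat /= af.
Qed.

Lemma homog_pullback k f : homog k f -> homog k (pullback pi f).
Proof. by move=> hf s sz; rewrite /pullback hf // size_map. Qed.

Lemma pullback_inj : limg pi = fullv -> injective (@pullback R g h pi).
Proof.
move=> pisurj a b ab; apply/funext=> s.
suff [t <-] : exists t, map pi t = s by exact: (congr1 (fun c : cform g => c t) ab).
elim: s => [|x s [t <-]]; first by exists [::].
have /memv_imgP[y _ ->] : x \in limg pi by rewrite pisurj memvf.
by exists (y :: t).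
Qed.

Hypothesis pi_lie : forall x y, pi lie[x, y] = lie[pi x, pi y].

Lemma dform_pullback f : dform (pullback pi f) = pullback pi (dform f).
Proof.
apply/funext=> s; rewrite /pullback /dform size_map.
apply: eq_bigr => i _; apply: eq_bigr => j _.
rewrite !(nth_map 0) // -pi_lie /=; congr (_ * f (_ :: _)).
rewrite /omit2 size_map -map_comp; apply/eq_in_map => k.
by rewrite mem_filter mem_iota /= => /andP[_ ks]; rewrite (nth_map 0).
Qed.

Variables (J : 'End(g)) (Jh : 'End(h)).
Hypothesis pi_J : forall x, pi (J x) = Jh (pi x).

Lemma type_comp_pullback p q f :
  type_comp J p q (pullback pi f) = pullback pi (type_comp Jh p q f).
Proof.
apply/funext=> s; elim: s p q f => [|v s IH] p q f //.
rewrite type_comp_cons /pullback /= type_comp_cons.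
rewrite -!/(pullback pi _ s) -!IH; congr (_ + _); congr (type_comp _ _ _ _ _);
  by rewrite /contract10 /contract01 -pi_J.
Qed.

Lemma type_part_pullback (p q : nat) f :
  type_part J p q (pullback pi f) = pullback pi (type_part Jh p q f).
Proof. by rewrite !type_compE type_comp_pullback. Qed.

Lemma pq_form_pullback (p q : nat) f :
  is_pq_form Jh p q f -> is_pq_form J p q (pullback pi f).
Proof.
move=> [/is_formP[af hf] tf]; split; last by rewrite type_part_pullback tf.
by apply/is_formP; split; [apply: altern_pullback|apply: homog_pullback].
Qed.

Lemma del_pullback f : del J (pullback pi f) = pullback pi (del Jh f).
Proof.
apply/funext=> s; rewrite /pullback /del size_map.
apply: eq_bigr => i _ /=; rewrite -/(pullback pi _ s).
by rewrite -type_part_pullback -dform_pullback -type_part_pullback.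
Qed.

Lemma delbar_pullback f : delbar J (pullback pi f) = pullback pi (delbar Jh f).
Proof.
apply/funext=> s; rewrite /pullback /delbar size_map.
apply: eq_bigr => i _ /=; rewrite -/(pullback pi _ s).
by rewrite -type_part_pullback -dform_pullback -type_part_pullback.
Qed.

End Pullback.

(** * Top degree and unimodularity *)

Section Dimension.
Variables (R : realType) (g : lieAlgebra R).
Implicit Types (f a b c : cform g) (s t : seq g) (u v x : g) (z : R[i]).

Lemma mlin_head_sum (I : Type) (r : seq I) (P : pred I) (k : I -> R) (e : I -> g) f :
  mlin f -> contract (\sum_(i <- r | P i) k i *: e i) f
            = \sum_(i <- r | P i) (k i)%:C%C *: contract (e i) f.
Proof.
move=> lf; elim: r => [|i r IH]; first by rewrite !big_nil mlin_head0.
by rewrite !big_cons; case: ifP => // _; rewrite mlin_head // IH.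
Qed.

Lemma mlin_span0 (X : seq g) f k : mlin f ->
  (forall s, size s = k -> {subset s <= X} -> f s = 0) ->
  forall s, size s = k -> {subset s <= <<X>>%VS} -> f s = 0.
Proof.
elim: k f => [|k IH] f lf f0 [|v s] //=; first by move=> _ _; apply: f0.
case=> sk sX; have vX : v \in <<in_tuple X>>%VS by apply: sX; rewrite mem_head.
rewrite -/(contract v f s) (coord_span vX) mlin_head_sum // cform_sum.
apply: big1 => i _; rewrite cformZ (IH (contract _ f)) ?mulr0 //.
- exact: mlin_contract.
- move=> t tk tX; apply: f0; rewrite /= ?tk // => y; rewrite inE => /predU1P[->|/tX//].
  by apply: mem_nth.
- by move=> y ys; apply: sX; rewrite inE ys orbT.
Qed.

(** Evaluated on basis vectors, more arguments than the dimension force a repetition. *)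
Lemma altern_gt_dim k f : altern f -> homog k f -> (\dim {:g} < k)%N -> f = 0.
Proof.
move=> af hf dk; apply/funext=> s; rewrite cform0.
have [sk|/hf//] := eqVneq (size s) k.
apply: (mlin_span0 (X := vbasis {:g}) af.1 _ sk) => [t tk tX|y _]; last first.
  by rewrite (span_basis (vbasisP _)) memvf.
apply: (altern_uniq af); apply/negP => ut.
by have := uniq_leq_size ut tX; rewrite size_tuple tk leqNgt dk.
Qed.

(** A full-length sequence of basis vectors either repeats one of them or is a permutation of
    [X]. *)
Lemma altern_top (X : seq g) f : basis_of fullv X -> altern f ->
  homog (\dim {:g}) f -> f X = 0 -> f = 0.
Proof.
move=> bX af hf fX; apply/funext=> s; rewrite cform0.
have sX : size X = \dim {:g}.
  by have /eqP <- := basis_free bX; rewrite (span_basis bX).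
have [sk|/hf//] := eqVneq (size s) (\dim {:g}).
apply: (mlin_span0 (X := X) af.1 _ sk) => [t tk tX|y _]; last first.
  by rewrite (span_basis bX) memvf.
have [ut|] := boolP (uniq t); last exact: altern_uniq.
have XU := free_uniq (basis_free bX).
apply: (altern_perm0 af _ fX); rewrite perm_sym; apply: uniq_perm => //.
by apply: (uniq_min_size ut tX _).2; rewrite tk sX.
Qed.

Lemma altern_span_head (Y t : seq g) v f : altern f ->
  v \in <<Y>>%VS -> {subset Y <= t} -> f (v :: t) = 0.
Proof.
move=> af vY Yt; have {}vY : v \in <<in_tuple Y>>%VS by [].
rewrite -/(contract v f t) (coord_span vY) mlin_head_sum; last by case: af.
rewrite cform_sum big1 // => i _; rewrite cformZ [contract _ _ _](altern_uniq af) ?mulr0 //=.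
by rewrite (Yt _ _) //; apply: mem_nth.
Qed.

Lemma lie_product_subr (U V : {vspace g}) : (U <= V)%VS ->
  (lie_product fullv U <= lie_product fullv V)%VS.
Proof.
move=> UV; apply/span_subvP => _ /allpairsP[[x y] /= [_ yU ->]].
by apply: mem_lie_product; rewrite ?memvf // (subvP UV) // vbasis_mem.
Qed.

Lemma lower_central_sub k : (lower_central g k.+1 <= lower_central g k)%VS.
Proof. by elim: k => [|k IH]; [rewrite subvf | apply: lie_product_subr]. Qed.

(** In such a list every ad y is strictly triangular: Engel's theorem in coordinates. *)
Definition central_flag (X : seq g) := forall Y x Z, X = Y ++ x :: Z ->
  forall y, lie[y, x] \in <<Z>>%VS.

(** The list is built from the end of the lower central series; each step puts in front a basis of a
    complement of one term in the preceding one. *)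
Lemma nilpotent_flag : lie_nilpotent g ->
  exists2 X, basis_of fullv X & central_flag X.
Proof.
case=> k k0; suff H j : (j <= k)%N ->
    exists2 X, basis_of (lower_central g (k - j)) X & central_flag X.
  by have := H k (leqnn k); rewrite subnn.
elim: j => [_|j IH jk].
  by exists [::]; [rewrite subn0 k0 nil_basis | case].
have [X bX fX] := IH (ltnW jk); set i := (k - j.+1)%N.
have ij : (k - j = i.+1)%N by rewrite /i; lia.
rewrite ij in bX.
set U := (lower_central g i :\: lower_central g i.+1)%VS.
exists (vbasis U ++ X).
  have -> : lower_central g i = (U + lower_central g i.+1)%VS.
    by rewrite addv_diff (addv_idPl (lower_central_sub i)).
  by apply: cat_basis (vbasisP _) bX; rewrite directv_addE /= !directvE /= capv_diff !eqxx.
have WU : {subset (vbasis U : seq g) <= U} by move=> u; apply: vbasis_mem.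
(* Either the cut of [W ++ X] lies in [X], where [fX] applies, or [x] belongs to the new layer and
   its brackets fall in the span of [X]. *)
move=> Y x Z /esym; move: (tval (vbasis U)) WU => W.
elim: Y W => [|y Y IHY] [|w W] //= WU.
- by case: X fX {bX} => // x' X fX [-> ->] y; apply: (fX [::]).
- case=> -> -> y; rewrite span_cat; apply: (subvP (addvSr _ _)).
  rewrite (span_basis bX); apply: mem_lie_product; rewrite ?memvf //.
  exact: (subvP (diffvSl _ _) _ (WU w (mem_head _ _))).
- by move=> XE; apply: (fX (y :: Y)); rewrite -XE.
- by case=> _; apply: IHY => u uW; apply: WU; rewrite inE uW orbT.
Qed.

(* Unimodularity: in a basis adapted to the lower central series, the bracket of
   two basis vectors is a combination of the other ones. *)
Lemma dform_codim1 k f : lie_nilpotent g -> altern f -> homog k f ->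
  \dim {:g} = k.+1 -> dform f = 0.
Proof.
move=> /nilpotent_flag[X bX flX] af hf dk.
apply: (altern_top bX); first exact: altern_dform.
  by rewrite dk; apply: homog_dform.
rewrite /dform big1 // => i _; rewrite big1 // => j ij.
(* Since i < j, all vectors after position j survive in [omit2], and the bracket lies in their
   span. *)
rewrite (@altern_span_head (drop j.+1 X)) ?mulr0 //.
  apply: (flX (take j X)); rewrite -drop_nth ?cat_take_drop //.
move=> y /(nthP 0)[l]; rewrite size_drop nth_drop => lj <-.
apply/mapP; exists (j.+1 + l)%N => //; rewrite mem_filter mem_iota /=.
by move: ij lj; case: i j => i /= iX [j /= jX]; lia.
Qed.

End Dimension.

(** * Vertical degree *)

Section VerticalDegree.
Variables (R : realType) (g : lieAlgebra R) (K : {vspace g}).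
Implicit Types (f a b c : cform g) (s t : seq g) (u v x : g) (z : R[i]).

Definition vdeg (m : nat) f := forall s, (m < count (mem K) s)%N -> f s = 0.

Lemma vdegW m l f : (m <= l)%N -> vdeg m f -> vdeg l f.
Proof. by move=> ml vf s ls; apply: vf; apply: leq_ltn_trans ls. Qed.

Lemma vdeg_homog k f : homog k f -> vdeg k f.
Proof.
move=> hf s ks; apply: hf; apply: contraTneq ks => <-.
by rewrite -leqNgt count_size.
Qed.

Lemma vdegD m a b : vdeg m a -> vdeg m b -> vdeg m (a + b).
Proof. by move=> va vb s ms; rewrite cformD va ?vb ?addr0. Qed.

Lemma vdegZ m z a : vdeg m a -> vdeg m (z *: a).
Proof. by move=> va s ms; rewrite cformZ va ?mulr0. Qed.

Lemma vdegN m a : vdeg m a -> vdeg m (- a).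
Proof. by move=> va s ms; rewrite cformN va ?oppr0. Qed.

Lemma vdegM m l a b : vdeg m a -> vdeg l b -> vdeg (m + l) (a * b).
Proof.
move=> va vb s ms; rewrite -[LHS]/(wedge a b s) /wedge big1 // => t _.
have ct : (count (mem K) (mask t s) + count (mem K) (mask (map negb t) s)
           = count (mem K) s)%N.
  have : size t = size s by rewrite size_tuple.
  move: (tval t) => {ms}{}t; elim: t s => [|e t IH] [|x s] //= [st].
  by rewrite -(IH s st); case: e => /=; lia.
have [mt|tm] := ltnP m (count (mem K) (mask t s)); first by rewrite va // mulr0 mul0r.
rewrite vb ?mulr0 // -(ltn_add2l m) (leq_trans ms) // -ct.
by rewrite leq_add2r.
Qed.

Lemma mlin_mem0 f s : mlin f -> 0 \in s -> f s = 0.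
Proof.
move=> lf; elim: s f lf => [|x s IH] f lf //; rewrite inE => /predU1P[<-|s0].
  by rewrite -/(contract 0 f s) mlin_head0.
by apply: (IH (contract x f)) => //; apply: mlin_contract.
Qed.

Hypothesis Kcent : (K <= lie_center g)%VS.

Lemma count_omit2 s i j : s`_i \notin K -> s`_j \notin K ->
  count (mem K) (omit2 s i j) = count (mem K) s.
Proof.
move=> iK jK; rewrite /omit2 count_map count_filter.
rewrite -[in RHS](mkseq_nth 0 s) /mkseq count_map; apply: eq_count => k /=.
case: (eqVneq k i) => [->|_]; first by rewrite andbF (negPf iK).
case: (eqVneq k j) => [->|_]; first by rewrite andbF (negPf jK).
by rewrite andbT.
Qed.

Lemma lie_mem_l x y : x \in K -> lie[x, y] = 0.
Proof. by move=> xK; apply: lie_centerP; apply: (subvP Kcent). Qed.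

Lemma lie_mem_r x y : y \in K -> lie[x, y] = 0.
Proof. by move=> yK; rewrite lie_sym lie_mem_l // oppr0. Qed.

Lemma dform_term0 f s i j : mlin f ->
  (s`_i \notin K -> s`_j \notin K -> f (lie[s`_i, s`_j] :: omit2 s i j) = 0) ->
  f (lie[s`_i, s`_j] :: omit2 s i j) = 0.
Proof.
move=> lf H; have [iK|iK] := boolP (s`_i \in K).
  by rewrite lie_mem_l // mlin_mem0 // mem_head.
have [jK|jK] := boolP (s`_j \in K); last exact: H.
by rewrite lie_mem_r // mlin_mem0 // mem_head.
Qed.

(** A bracket with an entry of [K] is zero; if both bracketed entries lie outside [K], all vertical
    entries remain among the other arguments. *)
Lemma vdeg_dform m f : mlin f -> vdeg m f -> vdeg m (dform f).
Proof.
move=> lf vf s ms; rewrite /dform big1 // => i _; rewrite big1 // => j _.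
rewrite dform_term0 ?mulr0 // => iK jK; apply: vf => /=.
by rewrite count_omit2 // (leq_trans ms) // leq_addl.
Qed.

(** Of the k + 2 arguments, the two that are bracketed must lie outside [K]. For a 2-form this
    bounds the vertical degree of its differential by 1. *)
Lemma vdeg_dform_homog k f : mlin f -> homog k.+1 f -> vdeg k (dform f).
Proof.
move=> lf hf s ks; rewrite /dform big1 // => i _; rewrite big1 // => j _.
rewrite dform_term0 ?mulr0 // => iK jK; apply: hf => /=.
rewrite eqSS; apply: contraTneq ks => <-.
by rewrite -leqNgt -(count_omit2 iK jK) count_size.
Qed.

Variable J : 'End(g).
Hypothesis JK : (J @: K <= K)%VS.

(** The type component evaluates [f] only at sequences where some entries v of [s] are replaced by J
    v; as [K] is J-stable, no vertical entry is lost. *)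
Lemma type_comp_count0 p q f s :
  (forall t, size t = size s -> (count (mem K) s <= count (mem K) t)%N -> f t = 0) ->
  type_comp J p q f s = 0.
Proof.
elim: s p q f => [|v s IH] p q f f0.
  by rewrite /type_comp /=; case: ifP => // _; apply: f0.
have f1 t : size t = size s -> (count (mem K) s <= count (mem K) t)%N ->
    f (v :: t) = 0 /\ f (J v :: t) = 0.
  move=> ts ct; split; apply: f0; rewrite /= ?ts // leq_add //.
  case: (boolP (v \in K)) => // vK; rewrite (subvP JK) //; exact: memv_img.
by rewrite type_comp_cons !IH ?addr0 // => t ts ct; have [fv fJv] := f1 t ts ct;
  rewrite /contract10 /contract01 !(cformZ, cformD, cformN) /contract fv fJv mulr0
    ?oppr0 addr0 mulr0.
Qed.

Lemma vdeg_type_comp p q m f : vdeg m f -> vdeg m (type_comp J p q f).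
Proof.
move=> vf s ms; apply: type_comp_count0 => t _ st; apply: vf.
exact: leq_trans ms st.
Qed.

(** A single shuffle survives: [b] takes [size e] arguments, and [a] accepts none of those in
    [e]. *)
Lemma mul_cat_vertical a b t e : vdeg 0 a -> homog (size e) b ->
  {subset e <= K} -> (a * b) (t ++ e) = a t * b e.
Proof.
move=> va hb eK; have pa c : vdeg 0 c -> vdeg 0 (parity c).
  by move=> vc s s0; rewrite /parity vc ?mulr0.
have cntE : count (mem K) e = size e.
  by apply/eqP; rewrite -all_count; apply/allP.
elim: t a va => [|v t IH] a va /=; last first.
  rewrite mul_cons IH => [|s s0]; last first.
    by apply: va; rewrite /= (leq_trans s0) // leq_addl.
  have -> : (parity a * contract v b) (t ++ e) = 0; last by rewrite addr0.
  (* For empty [e] the degree of [contract v b] cannot drop below [size e], but then [b] is a scalar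
     and its contraction is zero. *)
  case: (posnP (size e)) => [e0|e0].
    have -> : contract v b = 0 by apply: homog0_contract; rewrite -e0.
    by rewrite mulr0.
  have := homog_contract v hb => /vdeg_homog/(vdegM (pa _ va)); apply.
  by rewrite add0n count_cat cntE (leq_trans _ (leq_addl _ _)) // prednK.
elim: e b hb eK {cntE} a va => [|v e IH] b hb eK a va; first by rewrite mul_nil.
have vK : v \in K by apply: eK; rewrite mem_head.
rewrite mul_cons.
have -> : contract v a = 0 by apply/funext=> s; apply: va; rewrite /= vK.
rewrite mul0r cform0 add0r IH; last exact: pa.
- by rewrite /parity mul1r.
- exact: (homog_contract v hb).
- by move=> u ue; apply: eK; rewrite inE ue orbT.
Qed.

End VerticalDegree.

(** * Powers of a sum with nilpotent terms *)

Section NilpotentSum.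
Variables (A : nzRingType).
Implicit Types (x y : A).

Lemma exprD_trunc x y b m : GRing.comm x y -> y ^+ b.+1 = 0 ->
  (x + y) ^+ m = \sum_(i < b.+1) x ^+ (m - i) * y ^+ i *+ 'C(m, i).
Proof.
move=> cxy yb; rewrite exprDn_comm //.
pose G i := x ^+ (m - i) * y ^+ i *+ 'C(m, i).
rewrite -!(big_mkord xpredT G).
(* Both sums are extended to a common range: indices above b are killed by [yb], those above m by
   the binomial coefficient. *)
rewrite (big_nat_widen _ _ (m.+1 + b.+1)) ?leq_addr //=.
rewrite [RHS](big_nat_widen _ _ (m.+1 + b.+1)) ?leq_addl //=.
rewrite [LHS]big_mkcond [RHS]big_mkcond /=; apply: eq_bigr => i _.
case: ltnP => im; case: ltnP => ib //; rewrite /G.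
  by rewrite -(subnKC ib) exprD yb mul0r mulr0 mul0rn.
by rewrite bin_small // mulr0n.
Qed.

(** A monomial of degree [size r + 1] in [size r] commuting elements repeats one of them, and
    squares are zero. *)
Lemma exp_sum_nil (I : Type) (r : seq I) (a : I -> A) :
  (forall i x, GRing.comm (a i) x) -> (forall i, a i ^+ 2 = 0) ->
  (\sum_(i <- r) a i) ^+ (size r).+1 = 0.
Proof.
move=> ca a2; elim: r => [|i r IH]; first by rewrite big_nil expr1.
rewrite big_cons exprDn_comm //; apply: big1 => j _.
have [jr|jr] := leqP (size r).+1 j.
  by rewrite -(subnKC jr) exprD IH mul0r mulr0 mul0rn.
have -> : ((size (i :: r)).+1 - j = 2 + (size r - j))%N.
  by rewrite /= !subSn // leqW.
by rewrite exprD a2 !mul0r mul0rn.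
Qed.

End NilpotentSum.

(** * Nonvanishing of powers of a real (1,1)-form that is definite on a subspace *)

Lemma dim_regular (K : fieldType) : \dim {: K^o} = 1%N.
Proof. by rewrite dimvf. Qed.

Lemma dimv_cap_ker (K : fieldType) (V : vectType K) (U : {vspace V}) (f : 'Hom(V, K^o)) :
  (\dim U <= (\dim (U :&: lker f)).+1)%N.
Proof.
rewrite -(limg_ker_dim f U) -addn1 leq_add2l.
by rewrite -(dim_regular K) dimvS // subvf.
Qed.

Section Positivity.
Variables (R : realType) (g : lieAlgebra R) (J : 'End(g)).
Hypothesis JJ : forall x, J (J x) = - x.
Implicit Types (a : cform g) (s t : seq g) (u v x : g) (z : R[i]).

Variable D : cform g.
Hypothesis pqD : is_pq_form J 1 1 D.

Let aD : altern D. Proof. by case/is_pq_formP: pqD. Qed.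
Let hD : homog 2 D. Proof. by case: pqD => /is_formP[]. Qed.
Let pD : parity D = D.
Proof. by rewrite (homog_parity hD) -signr_odd scale1r. Qed.

(** In each surviving term one argument is contracted by type (1,0) and the other by (0,1), so [J]
    contributes i and -i, whose product is 1. *)
Lemma form11_J u v : D [:: J u; J v] = D [:: u; v].
Proof.
have [_] := pqD; rewrite type_compE.
have lD := aD.1.
set T := type_comp J 1 1 D => TD.
have E u' v' : D [:: u'; v'] = type_comp J 0 1 (contract10 J u' D) [:: v']
  + type_comp J 1 0 (contract01 J u' D) [:: v'] by rewrite -{1}TD.
rewrite !E (contract10J JJ) // (contract01J JJ) //.
rewrite (type_compZ _ _ _ 'i%C) (type_compZ _ _ _ (- 'i%C)).
rewrite !cformZ !type_comp_cons ![type_comp J (0 - 1) _ _]type_comp_lt0 //.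
rewrite ![type_comp J _ (0 - 1) _]type_comp_lt0 // !cform0 !add0r !addr0.
rewrite (contract10J JJ); last exact: mlin_contract01.
rewrite (contract01J JJ); last exact: mlin_contract10.
rewrite (type_compZ _ _ _ 'i%C) (type_compZ _ _ _ (- 'i%C)) !cformZ.
by have := sqr_i R; rewrite expr2 => ii; ring: ii.
Qed.

Hypothesis realD : conj_form D = D.

Lemma real_formE s : D s = (complex.Re (D s))%:C%C.
Proof.
have := congr1 (fun a => a s) realD; rewrite /conj_form.
case: (D s) => x y [] /eqP; rewrite eq_sym -addr_eq0 -mulr2n mulrn_eq0 /= => /eqP ->.
by [].
Qed.

(** Real-valued, so that the orthogonal of [u] is the kernel of an R-linear map and has codimension
    at most 1. *)
Definition re_right u (x : g) : R^o := complex.Re (D [:: u; x]).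

Lemma re_right_linear u : linear (re_right u).
Proof.
move=> k x y; rewrite /re_right; have := aD.1 [:: u] [::] k x y => /= ->.
by case: (D _) => ? ?; case: (D _) => ? ?; rewrite /= mul0r subr0.
Qed.
HB.instance Definition _ u :=
  GRing.isLinear.Build R g R^o *:%R (re_right u) (re_right_linear u).

Definition form_right u : 'Hom(g, R^o) := linfun (re_right u).

Lemma mem_form_right u x : (x \in lker (form_right u)) = (D [:: u; x] == 0).
Proof.
rewrite memv_ker lfunE /= real_formE.
by rewrite -(inj_eq (@complexI R)).
Qed.

Lemma contractX u m : contract u (D ^+ m.+1) = m.+1%:R *: (contract u D * D ^+ m).
Proof.
elim: m => [|m IH]; first by rewrite expr1 expr0 mulr1 scale1r.
rewrite exprS contractM pD IH -scalerAr mulrA (even_comm _ pD) -mulrA -exprS.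
by rewrite -[in RHS]natr1 scalerDl scale1r addrC.
Qed.

(** [u] can only be paired with [v], and m + 1 counts the factor in which this happens. *)
Lemma pow_pair u v s m : (forall x, x \in s -> D [:: u; x] = 0) ->
  (D ^+ m.+1) [:: u, v & s] = m.+1%:R * (D [:: u; v] * (D ^+ m) s).
Proof.
move=> us; rewrite -[LHS]/(contract u (D ^+ m.+1) (v :: s)) contractX cformZ.
congr (_ * _); rewrite mul_cons.
have -> : contract v (contract u D) = D [:: u; v] *: 1.
  apply/funext=> -[|w t]; rewrite cformZ ?mulr1 // ?mulr0.
  by rewrite /contract hD.
rewrite -scalerAl mul1r cformZ -[RHS]addr0; congr (_ + _).
rewrite -[LHS]/(wedge _ _ s) /wedge big1 // => t _.
suff -> : parity (contract u D) (mask t s) = 0 by rewrite mulr0 mul0r.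
rewrite /parity /contract; move E : (mask t s) => [|x [|y t']]; try by rewrite hD ?mulr0.
by rewrite us ?mulr0 //; apply: (mem_mask (m := t)); rewrite E mem_head.
Qed.

(** Gram-Schmidt by complex lines: the orthogonal of e and J e in [W] is J-stable of codimension at
    most 2, and putting e, J e in front of a sequence taken there multiplies the value by (m + 1)
    D(e, J e). *)
Lemma pow_neq0 (W : {vspace g}) m : (J @: W <= W)%VS ->
  (forall v, v \in W -> v != 0 -> D [:: v; J v] != 0) -> (2 * m <= \dim W)%N ->
  exists2 s, size s = (2 * m)%N /\ {subset s <= W} & (D ^+ m) s != 0.
Proof.
elim: m W => [|m IH] W JW posW dW.
  by exists [::] => //; rewrite oner_eq0.
have W0 : W != 0%VS by rewrite -dimv_eq0; lia.
have [eW e0] := (memv_pick W, W0); rewrite -vpick0 in e0.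
set e := vpick W in eW e0.
have JeW : J e \in W by apply: (subvP JW); apply: memv_img.
pose W' := (W :&: lker (form_right e) :&: lker (form_right (J e)))%VS.
have inW' x : x \in W' -> [/\ x \in W, D [:: e; x] = 0 & D [:: J e; x] = 0].
  by rewrite !memv_cap !mem_form_right => /andP[/andP[-> /eqP ->] /eqP ->].
have [||| s [ss sW] Ds] := IH W'.
- apply/subvP => _ /memv_imgP[x /inW'[xW ex Jex] ->].
  rewrite !memv_cap !mem_form_right form11_J ex eqxx andbT.
  rewrite (subvP JW) ?memv_img //=.
  have := form11_J (J e) x; rewrite JJ Jex.
  rewrite -[D [:: - e; _]]/(contract (- e) D [:: J x]) mlin_headN; last by case: aD.
  by rewrite cformN => /eqP; rewrite oppr_eq0.
- by move=> v /inW'[vW _ _]; apply: posW.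
- have := dimv_cap_ker W (form_right e).
  have := dimv_cap_ker (W :&: lker (form_right e)) (form_right (J e)).
  by rewrite -/W'; lia.
exists [:: e, J e & s].
  split; first by rewrite /= ss; lia.
  move=> x; rewrite !inE => /or3P[/eqP->//|/eqP->//|/sW/inW'[]//].
rewrite pow_pair; last by move=> x /sW/inW'[].
by rewrite !mulf_neq0 ?pnatr_eq0 // posW.
Qed.

End Positivity.

(** * Derivatives of powers of a (1,1)-form *)

Section Powers.
Variables (R : realType) (g : lieAlgebra R) (J : 'End(g)).
Hypothesis JJ : forall x, J (J x) = - x.
Variable D : cform g.
Hypothesis pqD : is_pq_form J 1 1 D.
Implicit Types (A : cform g) (k : int).

Let aD : altern D. Proof. by case/is_pq_formP: pqD. Qed.
Let hD : homog 2 D. Proof. by case: pqD => /is_formP[]. Qed.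
Let pD : parity D = D.
Proof. by rewrite (homog_parity hD) -signr_odd scale1r. Qed.

Lemma parity_wedge_pow k : parity (wedge_pow D k) = wedge_pow D k.
Proof.
case: k => k; last by rewrite linear0.
rewrite wedge_powE; elim: k => [|k IH]; first exact: parity1.
by rewrite exprS parityM pD IH.
Qed.

Lemma pq_form0 p q : is_pq_form J p q 0.
Proof. by apply/is_pq_formP; rewrite type_comp0; split=> //; apply: altern0. Qed.

Lemma pq_form_wedge_pow k : is_pq_form J `|k| `|k| (wedge_pow D k).
Proof.
case: k => k; last exact: pq_form0.
by rewrite wedge_powE; have := pq_formX JJ k pqD; rewrite muln1.
Qed.

Lemma altern_wedge_pow k : altern (wedge_pow D k).
Proof. by have /is_pq_formP[] := pq_form_wedge_pow k. Qed.

(** One computation for [dform], [del] and [delbar]; the Leibniz rule is asked on powers of [D]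
    because for [del] and [delbar] it is available on forms of pure type. For k <= 0 both sides are
    0. *)
Lemma even_derivation_pow (dd : cform g -> cform g) : dd 0 = 0 ->
  (forall k l : nat, dd (D ^+ k * D ^+ l) = dd (D ^+ k) * D ^+ l + D ^+ k * dd (D ^+ l)) ->
  forall k : int, dd (wedge_pow D k) = k%:~R *: (wedge_pow D (k - 1) * dd D).
Proof.
move=> dd0 ddM [[|k]|k].
- rewrite scale0r -[wedge_pow D 0]/(1 : cform g).
  (* The Leibniz rule for 1 = 1 * 1 forces [dd 1 = 0]. *)
  have := ddM 0%N 0%N; rewrite !expr0 !mulr1 mul1r => H.
  by apply: (addIr (dd 1)); rewrite -H add0r.
- have -> : k.+1%:Z - 1 = k by lia.
  rewrite !wedge_powE; elim: k => [|k IH].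
    by rewrite expr0 mul1r expr1 scale1r.
  rewrite exprS -[D in D * _]expr1 ddM expr1 IH -scalerAr mulrA -exprS.
  rewrite -(even_comm _ (_ : parity (D ^+ k.+1) = D ^+ k.+1)).
    by rewrite -[X in X + _]scale1r -scalerDl -[k.+2]add1n PoszD intrD.
  by rewrite -wedge_powE parity_wedge_pow.
- rewrite (_ : Negz k - 1 = Negz k.+1); last by rewrite !NegzE; lia.
  by rewrite mul0r scaler0.
Qed.

Lemma dform_wedge_pow k :
  dform (wedge_pow D k) = k%:~R *: (wedge_pow D (k - 1) * dform D).
Proof.
apply: even_derivation_pow; first exact: linear0.
move=> p q; rewrite dformM; try exact: alternX.
by rewrite -!wedge_powE parity_wedge_pow.
Qed.

Lemma del_wedge_pow k :
  del J (wedge_pow D k) = k%:~R *: (wedge_pow D (k - 1) * del J D).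
Proof.
apply: even_derivation_pow; first exact: linear0.
move=> p q; rewrite (delM JJ (pq_formX JJ p pqD) (pq_formX JJ q pqD)).
by rewrite -!wedge_powE parity_wedge_pow.
Qed.

Lemma delbar_wedge_pow k :
  delbar J (wedge_pow D k) = k%:~R *: (wedge_pow D (k - 1) * delbar J D).
Proof.
apply: even_derivation_pow; first exact: linear0.
move=> p q; rewrite (delbarM JJ (pq_formX JJ p pqD) (pq_formX JJ q pqD)).
by rewrite -!wedge_powE parity_wedge_pow.
Qed.

Lemma dform_mul_pow A k : altern A -> parity A = A ->
  dform (A * wedge_pow D k)
  = dform A * wedge_pow D k + k%:~R *: (A * wedge_pow D (k - 1) * dform D).
Proof.
move=> aA pA; rewrite dformM //; last exact: altern_wedge_pow.
by rewrite pA dform_wedge_pow -scalerAr mulrA.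
Qed.

Lemma delbar_mul_pow (p q : nat) A k : is_pq_form J p q A -> parity A = A ->
  delbar J (A * wedge_pow D k)
  = delbar J A * wedge_pow D k + k%:~R *: (A * (wedge_pow D (k - 1) * delbar J D)).
Proof.
move=> pqA pA; rewrite (delbarM JJ pqA (pq_form_wedge_pow k)).
by rewrite pA delbar_wedge_pow -scalerAr.
Qed.

(** The signs are grouped as in the right-hand side of (ii), so that a combination of instances
    yields minus that expression. The sign of the first inner term comes from delbar A being odd. *)
Lemma del_delbar_mul_pow (p q : nat) A k : is_pq_form J p q A -> parity A = A ->
  del J (delbar J (A * wedge_pow D k))
  = del J (delbar J A) * wedge_pow D k
    - (k%:~R *: (delbar J A * wedge_pow D (k - 1) * del J D)
       - k%:~R *: (del J A * wedge_pow D (k - 1) * delbar J D)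
       - (k%:~R * (k - 1)%:~R) *: (A * wedge_pow D (k - 2) * del J D * delbar J D)
       - k%:~R *: (A * wedge_pow D (k - 1) * del J (delbar J D))).
Proof.
move=> pqA pA; rewrite (delbar_mul_pow _ pqA pA) delD delZ.
have pqdA := pq_form_delbar JJ pqA.
have pqdD := pq_form_delbar JJ pqD.
have pqk l := pq_form_wedge_pow l.
have podd : parity (delbar J A) = - delbar J A.
  rewrite (delbarE JJ pqA) -type_comp_parity -type_compN; congr (type_comp _ _ _ _).
  have /is_pq_formP[aA _] := pqA.
  by rewrite -[RHS]opprK -[in RHS]pA dform_parity // !opprK.
rewrite (delM JJ pqdA (pqk k)) podd.
rewrite (delM JJ pqA (pq_form_mul JJ (pqk (k - 1)) pqdD)) pA.
rewrite (delM JJ (pqk (k - 1)) pqdD) parity_wedge_pow !del_wedge_pow.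
have -> : k - 1 - 1 = k - 2 by lia.
rewrite -!scalerAr -!scalerAl mulrDr -!scalerAr !mulrA mulNr !scalerDr scalerA.
by rewrite !opprD !opprK !addrA mulNr scalerN.
Qed.

End Powers.

Lemma size_filter_geq_ord (m n : nat) :
  size [seq k : 'I_n <- index_enum 'I_n | (m <= k)%N] = (n - m)%N.
Proof.
rewrite size_filter -sum1_count -(big_mkord (fun k => m <= k)%N (fun=> 1%N)).
have [mn|nm] := leqP m n; last first.
  rewrite big_nat_cond big1 ?(eqP (ltnW nm)) // => i.
  by case/andP=> /andP[_ /ltn_trans/(_ nm) im]; rewrite leqNgt im.
rewrite (big_cat_nat _ mn) //= big_nat_cond big1 ?add0n => [|i]; last first.
  by case/andP=> /andP[_ im]; rewrite leqNgt im.
rewrite big_nat_cond (eq_bigl (fun i => (m <= i < n) && true)%N); last first.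
  by move=> i; case: (leqP m i).
by rewrite -big_nat_cond sum_nat_const_nat muln1.
Qed.

(** * Surviving terms of the binomial expansions *)

Section TruncatedBinomial.
Variables (A : nzRingType) (x y : A) (t b : nat).
Hypotheses (cxy : GRing.comm x y) (xt : x ^+ t.+2 = 0) (yb : y ^+ b.+2 = 0).

(** [t + 1] and [b + 1] stand for nt and n - nt, so the exponent is n - 1. It is one below the
    largest total degree of a nonzero monomial, which leaves two terms. *)
Lemma exprD_trunc1 : (x + y) ^+ (t + b).+1
  = x ^+ t.+1 * y ^+ b *+ 'C((t + b).+1, b) + x ^+ t * y ^+ b.+1 *+ 'C((t + b).+1, b.+1).
Proof.
rewrite (exprD_trunc _ cxy yb) !big_ord_recr /= big1 ?add0r => [|i _].
  by congr (_ * _ *+ _ + _ * _ *+ _); congr (x ^+ _); lia.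
have -> : ((t + b).+1 - i = t.+2 + (b - i.+1))%N by case: i => i /=; lia.
by rewrite exprD xt !mul0r mul0rn.
Qed.

(** Now the exponent is n - 2, which leaves three terms. For t = 0 the truncated [t.-1] is harmless,
    its binomial coefficient being zero; for b = 0 the last exponent of y would be negative. *)
Lemma exprD_trunc2 : (x + y) ^+ (t + b)
  = x ^+ t.-1 * y ^+ b.+1 *+ 'C(t + b, b.+1) + x ^+ t * y ^+ b *+ 'C(t + b, b)
    + (if b is b'.+1 then x ^+ t.+1 * y ^+ b' *+ 'C(t + b, b') else 0).
Proof.
rewrite (exprD_trunc _ cxy yb) !big_ord_recr /=.
rewrite -addrA [LHS]addrC [X in X + _ = _]addrC; congr (_ + _).
  by congr (_ * _ *+ _ + _ * _ *+ _); congr (x ^+ _); lia.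
case: b => [|b']; first by rewrite big_ord0.
rewrite big_ord_recr /= big1 ?add0r => [|i _].
  by congr (_ * _ *+ _); congr (x ^+ _); lia.
have -> : (t + b'.+1 - i = t.+2 + (b' - i.+1))%N by case: i => i /=; lia.
by rewrite exprD xt !mul0r mul0rn.
Qed.

End TruncatedBinomial.

(** * Nilpotency of the vertical form *)

Section VerticalForm.
Variables (R : realType) (g : lieAlgebra R) (m n : nat) (w : 'I_n -> cform g).
Hypothesis hw : forall k, homog 1 (w k).

Lemma vertical_form_nil : vertical_form m w ^+ (n - m).+1 = 0.
Proof.
rewrite /vertical_form exprZn -big_filter -size_filter_geq_ord exp_sum_nil ?scaler0 //.
  move=> i x; apply: even_comm; rewrite wedgeE parityM.
  have hc : homog 1 (conj_form (w i)).
    by move=> s s1; rewrite /conj_form hw // conjc0.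
  by rewrite (homog_parity (hw i)) (homog_parity hc) !expr1 !scaleN1r mulrNN.
move=> i; have pw : parity (w i) = - w i.
  by rewrite (homog_parity (hw i)) expr1 scaleN1r.
(* An odd element anticommutes with itself, and 2 is invertible. *)
have w2 : w i * w i = 0.
  have := odd_comm (w i) pw; rewrite pw mulNr => /eqP.
  rewrite -addr_eq0 -mulr2n -scaler_nat scaler_eq0 pnatr_eq0 /=.
  by move/eqP.
rewrite expr2 wedgeE mulrA -(mulrA (w i)) -[X in _ * X * _]opprK.
have -> : - (conj_form (w i) * w i) = w i * conj_form (w i).
  rewrite (odd_comm (conj_form (w i)) pw) -mulNr; congr (_ * _).
  have hc : homog 1 (conj_form (w i)).
    by move=> s s1; rewrite /conj_form hw // conjc0.
  by rewrite (homog_parity hc) expr1 scaleN1r.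
by rewrite mulrN mulrA w2 !mul0r oppr0 mul0r.
Qed.

End VerticalForm.

(** * Balanced and astheno-Kähler metrics on a central extension *)

Section Equivalences.
Variables (R : realType) (g h : lieAlgebra R) (J : 'End(g)) (Jh : 'End(h)).
Variables (pi : 'Hom(g, h)) (n nt : nat) (F D : cform g) (Ft : cform h).
Hypothesis JJ : forall x, J (J x) = - x.
Hypothesis JJh : forall x, Jh (Jh x) = - x.
Hypothesis dim_g : \dim {:g} = (2 * n)%N.
Hypothesis dim_h : \dim {:h} = (2 * nt)%N.
Hypothesis nil_h : lie_nilpotent h.
Hypothesis K_cent : (lker pi <= lie_center g)%VS.
Hypothesis K_J : (J @: lker pi <= lker pi)%VS.
Hypothesis K_neq0 : lker pi != 0%VS.
Hypothesis K_neqT : lker pi != fullv.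
Hypothesis pi_surj : limg pi = fullv.
Hypothesis pi_lie : forall x y, pi lie[x, y] = lie[pi x, pi y].
Hypothesis pi_J : forall x, pi (J x) = Jh (pi x).
Hypothesis hF : hermitian_metric J F.
Hypothesis hFt : hermitian_metric Jh Ft.
Hypothesis FE : F = pullback pi Ft + D.
Hypothesis Dnil : D ^+ (n - nt).+1 = 0.

Local Notation b := (n - nt)%N.
Local Notation P := (pullback pi Ft).
Local Notation K := (lker pi).

Lemma dim_ker : \dim K = (2 * b)%N.
Proof.
have := limg_ker_dim pi fullv; rewrite capfv pi_surj dim_g dim_h.
by move=> H; rewrite mulnBr -H addnK.
Qed.

Let b_gt0 : (0 < b)%N.
Proof. by have := dim_ker; move: K_neq0; rewrite -dimv_eq0; lia. Qed.

Let nt_gt0 : (0 < nt)%N.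
Proof.
rewrite lt0n; apply: contraNneq K_neqT => nt0.
by rewrite eqEdim subvf dim_g dim_ker nt0 subn0 /=.
Qed.

Let nE : n = (nt + b)%N. Proof. by move: b_gt0; lia. Qed.

Let pqFt : is_pq_form Jh 1 1 Ft. Proof. by case: hFt. Qed.
Let pqP : is_pq_form J 1 1 P. Proof. exact: pq_form_pullback pi_J _ _ _ pqFt. Qed.
Let pqD : is_pq_form J 1 1 D.
Proof.
have -> : D = F + (-1) *: P by rewrite FE scaleN1r addrAC subrr add0r.
by apply: pq_formD; [case: hF|apply: pq_formZ].
Qed.
Let aD : altern D. Proof. by case/is_pq_formP: pqD. Qed.
Let hD : homog 2 D. Proof. by case: pqD => /is_formP[]. Qed.
Let pD : parity D = D.
Proof. by rewrite (homog_parity hD) -signr_odd scale1r. Qed.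
Let aFt : altern Ft. Proof. by case/is_pq_formP: pqFt. Qed.
Let hFt2 : homog 2 Ft. Proof. by case: pqFt => /is_formP[]. Qed.

Let real_D : conj_form D = D.
Proof.
have [_ rF _] := hF; have [_ rFt _] := hFt.
have -> : D = F - P by rewrite FE addrAC subrr add0r.
apply/funext=> s; rewrite /conj_form cformD cformN rmorphB /=.
congr (_ - _); first exact: (congr1 (fun a : cform g => a s) rF).
exact: (congr1 (fun a : cform h => a (map pi s)) rFt).
Qed.

Lemma vdeg_pullback (a : cform h) : mlin a -> vdeg K 0 (pullback pi a).
Proof.
move=> la s; rewrite -has_count => /hasP[x xs xK].
rewrite /pullback mlin_mem0 //; apply/mapP; exists x => //.
by move: xK; rewrite /= memv_ker => /eqP.
Qed.

(** On [K] the pulled back metric vanishes, so [D] agrees there with the positive form [F]. *)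
Lemma vertical_top_neq0 :
  exists2 e, size e = (2 * b)%N /\ {subset e <= K} & (D ^+ b) e != 0.
Proof.
apply: (pow_neq0 JJ pqD real_D K_J); last by rewrite dim_ker.
move=> v vK v0; have [_ _ posF] := hF; have := posF v v0.
have vJ : J v \in K by rewrite (subvP K_J) ?memv_img.
rewrite FE cformD (_ : P _ = 0) ?add0r; first by move=> /lt0r_neq0.
by apply: vdeg_pullback; [case: aFt | rewrite /= vK vJ].
Qed.

Lemma vertical_separation (a : cform h) (X : cform g) : altern a ->
  vdeg K (2 * b - 1) X ->
  (pullback pi a * D ^+ b + X = 0 <-> a = 0 /\ X = 0).
Proof.
move=> aa vX; split=> [E|[-> ->]]; last by rewrite pullback0 mul0r addr0.
suff a0 : a = 0.
  by split=> //; move: E; rewrite a0 pullback0 mul0r add0r.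
apply: (pullback_inj pi_surj); rewrite pullback0.
have [e [se eK] De] := vertical_top_neq0.
apply/funext=> t; rewrite cform0; apply/eqP.
(* At [t ++ e] the product splits as the pullback at [t] times the nonzero scalar D^b(e), and [X]
   vanishes because it receives 2b vertical arguments. *)
have := congr1 (fun c : cform g => c (t ++ e)) E.
rewrite cformD (@mul_cat_vertical _ _ K) //; last first.
- by rewrite se; apply: homogX.
- by apply: vdeg_pullback; case: aa.
rewrite vX ?addr0 ?cform0; last first.
  rewrite count_cat (_ : count (mem K) e = 2 * b)%N; first by move: b_gt0; lia.
  by rewrite -se; apply/eqP; rewrite -all_count; apply/allP.
by move/eqP; rewrite mulf_eq0 (negPf De) orbF.
Qed.

Lemma Ft_top (j : nat) : (nt < j)%N -> Ft ^+ j = 0.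
Proof.
move=> ntj; apply: (@altern_gt_dim _ _ (2 * j)); [exact: alternX|exact: homogX|].
by rewrite dim_h ltn_mul2l.
Qed.

Let cPD : GRing.comm P D. Proof. exact/esym/even_comm. Qed.

Let P_top : P ^+ nt.+1 = 0.
Proof. by rewrite -pullbackX Ft_top // pullback0. Qed.

Lemma fundamental_pow1 : F ^+ (n - 1)
  = 'C(n - 1, b - 1)%:R *: (wedge_pow P (n%:Z - b%:Z) * wedge_pow D (b%:Z - 1))
    + 'C(n - 1, b)%:R *: (wedge_pow P (n%:Z - 1 - b%:Z) * wedge_pow D b%:Z).
Proof.
move: nE b_gt0 nt_gt0 Dnil P_top; set b0 := b.
case: b0 => // b1; case: nt => // t -> _ _ Dn Pn.
rewrite FE (_ : t.+1 + b1.+1 - 1 = (t + b1).+1)%N; last lia.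
rewrite (exprD_trunc1 cPD Pn Dn) !scaler_nat.
have -> : (t.+1 + b1.+1)%N%:Z - b1.+1%:Z = t.+1 by lia.
have -> : (t.+1 + b1.+1)%N%:Z - 1 - b1.+1%:Z = t by lia.
have -> : b1.+1%:Z - 1 = b1 by lia.
by rewrite !wedge_powE subSS subn0.
Qed.

Lemma fundamental_pow2 : F ^+ (n - 2)
  = 'C(n - 2, b)%:R *: (wedge_pow P (n%:Z - 2 - b%:Z) * wedge_pow D b%:Z)
    + 'C(n - 2, b - 1)%:R *: (wedge_pow P (n%:Z - 1 - b%:Z) * wedge_pow D (b%:Z - 1))
    + 'C(n - 2, b - 2)%:R *: (wedge_pow P (n%:Z - b%:Z) * wedge_pow D (b%:Z - 2)).
Proof.
move: nE b_gt0 nt_gt0 Dnil P_top; set b0 := b.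
case: b0 => // b1; case: nt => // t -> _ _ Dn Pn.
rewrite FE (_ : t.+1 + b1.+1 - 2 = t + b1)%N; last lia.
rewrite (exprD_trunc2 cPD Pn Dn) !scaler_nat.
have -> : (t.+1 + b1.+1)%N%:Z - b1.+1%:Z = t.+1 by lia.
have -> : (t.+1 + b1.+1)%N%:Z - 1 - b1.+1%:Z = t by lia.
have -> : b1.+1%:Z - 1 = b1 by lia.
rewrite !wedge_powE subSS subn0; congr (_ + _ + _).
(* For nt = 1 the exponents disagree (0 against -1), but the binomial coefficient is zero. *)
- case: t Pn => [|t] Pn; first by rewrite bin_small ?mulr0n.
  by rewrite (_ : (t.+2 + b1.+1)%N%:Z - 2 - b1.+1%:Z = t) ?wedge_powE //; lia.
(* For b = 1 the third term contains D^(-1), which is 0 by convention. *)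
case: b1 Dn => [|b2] Dn; first by rewrite /= mulr0 mul0rn.
rewrite (_ : b2.+2%:Z - 2 = b2); last lia.
by rewrite wedge_powE subSS subSS subn0.
Qed.

Let compl_dim_g : complex_dim g = n.
Proof. by rewrite /complex_dim dim_g mul2n doubleK. Qed.
Let compl_dim_h : complex_dim h = nt.
Proof. by rewrite /complex_dim dim_h mul2n doubleK. Qed.

Lemma wedge_pow_F (j : nat) : (j <= n)%N -> wedge_pow F (n%:Z - j%:Z) = F ^+ (n - j).
Proof. by move=> jn; rewrite (_ : n%:Z - j%:Z = (n - j)%N) ?wedge_powE //; lia. Qed.

Let ntZ : n%:Z - b%:Z = nt. Proof. by move: nE; lia. Qed.
Let ntZ1 : n%:Z - 1 - b%:Z = nt%:Z - 1. Proof. by move: nE; lia. Qed.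
Let ntZ2 : n%:Z - 2 - b%:Z = nt%:Z - 2. Proof. by move: nE; lia. Qed.

Let aPow (k : int) : altern (wedge_pow P k).
Proof. exact: (altern_wedge_pow JJ pqP). Qed.
Let pPow (k : int) : parity (wedge_pow P k) = wedge_pow P k.
Proof. exact: (parity_wedge_pow pqP). Qed.
Let aFPow (k : int) : altern (wedge_pow Ft k).
Proof. exact: (altern_wedge_pow JJh pqFt). Qed.

(** The bound is written in [int] so that one statement also covers a negative exponent, for which
    the term is zero. *)
Lemma vdeg_term (k : int) (r m : nat) (A : cform h) (E : cform g) :
  2 * k + r%:Z <= m%:Z -> altern A -> vdeg K r E ->
  vdeg K m (pullback pi A * wedge_pow D k * E).
Proof.
case: k => k km aA vE; last by rewrite /= mulr0 mul0r.
apply: (@vdegW _ _ _ (0 + 2 * k + r)); first by lia.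
apply: vdegM => //; apply: vdegM; first by apply: vdeg_pullback; case: aA.
by rewrite wedge_powE; apply/vdeg_homog/homogX.
Qed.

Let vdD : vdeg K 1 (dform D).
Proof. by apply: (vdeg_dform_homog K_cent) => //; case: aD. Qed.

Let balanced_aux : dform (F ^+ (n - 1))
  = pullback pi ('C(n - 1, b)%:R *: dform (wedge_pow Ft (nt%:Z - 1))) * D ^+ b
    + (((b%:Z - 1)%:~R * 'C(n - 1, b - 1)%:R)
        *: (pullback pi (wedge_pow Ft (n%:Z - b%:Z)) * wedge_pow D (b%:Z - 2))
       + (b%:Z%:~R * 'C(n - 1, b)%:R)
        *: (pullback pi (wedge_pow Ft (n%:Z - 1 - b%:Z)) * wedge_pow D (b%:Z - 1)))
      * dform D.
Proof.
rewrite fundamental_pow1 dformD !dformZ.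
rewrite !(dform_mul_pow JJ pqD) //.
rewrite ntZ1 ntZ !wedge_powE -(pullbackX pi Ft nt) dform_pullback //.
(* Ft^nt has top degree on [h], so the degree of its differential exceeds the dimension. *)
rewrite (_ : dform (Ft ^+ nt) = 0); last first.
  apply: (@altern_gt_dim _ _ (2 * nt).+1); rewrite ?dim_h //.
    by apply: altern_dform; apply: alternX.
  by apply: homog_dform; [apply: alternX|apply: homogX].
rewrite pullback0 mul0r add0r -pullback_wedge_pow dform_pullback //.
rewrite pullbackZ scalerDr !scalerA.
rewrite (_ : b%:Z - 1 - 1 = b%:Z - 2); last by lia.
rewrite addrCA -scalerAl; congr (_ + _).
by rewrite mulrDl -!scalerAl ['C(n - 1, b - 1)%:R * _]mulrC ['C(n - 1, b)%:R * _]mulrC.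
Qed.

Lemma balanced_iff : balanced F <-> balanced Ft /\
  (((b%:Z - 1)%:~R * 'C(n - 1, b - 1)%:R)
        *: (pullback pi (wedge_pow Ft (n%:Z - b%:Z)) * wedge_pow D (b%:Z - 2))
       + (b%:Z%:~R * 'C(n - 1, b)%:R)
        *: (pullback pi (wedge_pow Ft (n%:Z - 1 - b%:Z)) * wedge_pow D (b%:Z - 1)))
      * dform D = 0.
Proof.
rewrite /balanced compl_dim_g compl_dim_h wedge_pow_F; last by move: nE; lia.
rewrite balanced_aux.
(* nt > 0 gives b <= n - 1, so the coefficient of the isolated term can be cancelled. *)
have c0 : 'C(n - 1, b)%:R != 0 :> R[i].
  by rewrite pnatr_eq0 -lt0n bin_gt0; move: nE nt_gt0; lia.
rewrite vertical_separation; last first.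
- rewrite mulrDl -!scalerAl; apply: vdegD; apply: vdegZ; apply: (vdeg_term _ _ vdD) => //.
    by move: b_gt0; lia.
  by move: b_gt0; lia.
- by apply: alternZ; apply: altern_dform.
split=> -[d0 ->]; split=> //; last by rewrite d0 scaler0.
by move/eqP: d0; rewrite scaler_eq0 (negPf c0) => /eqP.
Qed.

Let pqFPow (k : int) : is_pq_form Jh `|k| `|k| (wedge_pow Ft k).
Proof. exact: (pq_form_wedge_pow JJh pqFt). Qed.

Let del_top : del Jh (Ft ^+ nt) = 0 /\ delbar Jh (Ft ^+ nt) = 0.
Proof.
have pq := pqFPow nt; rewrite wedge_powE in pq.
rewrite (delE JJh pq) (delbarE JJh pq) (_ : dform (Ft ^+ nt) = 0) ?type_comp0 //.
apply: (@altern_gt_dim _ _ (2 * nt).+1); rewrite ?dim_h //.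
  by apply: altern_dform; apply: alternX.
by apply: homog_dform; [apply: alternX|apply: homogX].
Qed.

(** delbar Ft^(nt-1) has degree 2nt - 1, one below the dimension, and in that degree [dform] is zero
    on a nilpotent algebra. *)
Let del_delbar_codim1 : del Jh (delbar Jh (wedge_pow Ft (nt%:Z - 1))) = 0.
Proof.
have -> : nt%:Z - 1 = nt.-1 by move: nt_gt0; lia.
have pq := pq_form_delbar JJh (pqFPow nt.-1).
rewrite (delE JJh pq) (_ : dform _ = 0) ?type_comp0 //.
have [/is_formP[aa ha] _] := pq.
by apply: (dform_codim1 nil_h aa ha); rewrite dim_h; move: nt_gt0; lia.
Qed.

Let pqdD := pq_form_del JJ pqD.
Let pqdbD := pq_form_delbar JJ pqD.

Let vdelD : vdeg K 1 (del J D).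
Proof. by rewrite (delE JJ pqD); apply: vdeg_type_comp. Qed.
Let vdelbarD : vdeg K 1 (delbar J D).
Proof. by rewrite (delbarE JJ pqD); apply: vdeg_type_comp. Qed.
Let vdeldelbarD : vdeg K 1 (del J (delbar J D)).
Proof.
rewrite (delE JJ pqdbD); apply: vdeg_type_comp => //; apply: vdeg_dform => //.
by have /is_pq_formP[[]] := pqdbD.
Qed.

(** The right-hand side of (ii), which collects the terms where [D] is differentiated. *)
Let Q := ((b%:Z%:~R * 'C(n - 2, b)%:R)
                *: (pullback pi (delbar Jh (wedge_pow Ft (n%:Z - 2 - b%:Z)))
                      * wedge_pow D (b%:Z - 1))
              + ((b%:Z - 1)%:~R * 'C(n - 2, b - 1)%:R)
                *: (pullback pi (delbar Jh (wedge_pow Ft (n%:Z - 1 - b%:Z)))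
                      * wedge_pow D (b%:Z - 2)))
             * del J D
           - ((b%:Z%:~R * 'C(n - 2, b)%:R)
                *: (pullback pi (del Jh (wedge_pow Ft (n%:Z - 2 - b%:Z)))
                      * wedge_pow D (b%:Z - 1))
              + ((b%:Z - 1)%:~R * 'C(n - 2, b - 1)%:R)
                *: (pullback pi (del Jh (wedge_pow Ft (n%:Z - 1 - b%:Z)))
                      * wedge_pow D (b%:Z - 2)))
             * delbar J D
           - ((b%:Z%:~R * (b%:Z - 1)%:~R * 'C(n - 2, b)%:R)
                *: (pullback pi (wedge_pow Ft (n%:Z - 2 - b%:Z)) * wedge_pow D (b%:Z - 2))
              + ((b%:Z - 1)%:~R * (b%:Z - 2)%:~R * 'C(n - 2, b - 1)%:R)
                *: (pullback pi (wedge_pow Ft (n%:Z - 1 - b%:Z)) * wedge_pow D (b%:Z - 3))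
              + ((b%:Z - 2)%:~R * (b%:Z - 3)%:~R * 'C(n - 2, b - 2)%:R)
                *: (pullback pi (wedge_pow Ft (n%:Z - b%:Z)) * wedge_pow D (b%:Z - 4)))
             * del J D * delbar J D
           - ((b%:Z%:~R * 'C(n - 2, b)%:R)
                *: (pullback pi (wedge_pow Ft (n%:Z - 2 - b%:Z)) * wedge_pow D (b%:Z - 1))
              + ((b%:Z - 1)%:~R * 'C(n - 2, b - 1)%:R)
                *: (pullback pi (wedge_pow Ft (n%:Z - 1 - b%:Z)) * wedge_pow D (b%:Z - 2))
              + ((b%:Z - 2)%:~R * 'C(n - 2, b - 2)%:R)
                *: (pullback pi (wedge_pow Ft (n%:Z - b%:Z)) * wedge_pow D (b%:Z - 3)))
             * del J (delbar J D).

Let del_delbar_pow : del J (delbar J (F ^+ (n - 2)))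
  = pullback pi ('C(n - 2, b)%:R *: del Jh (delbar Jh (wedge_pow Ft (nt%:Z - 2)))) * D ^+ b
    - Q.
Proof.
have pqPow k : is_pq_form J `|k| `|k| (wedge_pow P k) by apply: (pq_form_wedge_pow JJ pqP).
rewrite fundamental_pow2 !delbarD !delbarZ !delD !delZ.
rewrite !(del_delbar_mul_pow JJ pqD _ (pqPow _) (pPow _)).
rewrite -!pullback_wedge_pow !(delbar_pullback pi_lie pi_J) !(del_pullback pi_lie pi_J).
rewrite /Q ntZ ntZ1 ntZ2 del_delbar_codim1 !wedge_powE.
(* The first derivatives of the top power Ft^nt also vanish; this is why the first two brackets of
   (ii) have two terms and the last two have three. *)
have [-> ->] := del_top; rewrite del0 !pullback0 !mul0r !scaler0.
have -> : b%:Z - 1 - 1 = b%:Z - 2 by lia.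
have -> : b%:Z - 1 - 2 = b%:Z - 3 by lia.
have -> : b%:Z - 2 - 1 = b%:Z - 3 by lia.
have -> : b%:Z - 2 - 2 = b%:Z - 4 by lia.
have mulZl (z : R[i]) (x y : cform g) : (z *: x) * y = z *: (x * y) by rewrite scalerAl.
rewrite pullbackZ !mulrDl !mulZl.
by apply/funext=> s; rewrite !(cformD, cformN, cformZ, cform0); ring.
Qed.

Lemma astheno_iff : astheno_kahler J F <-> astheno_kahler Jh Ft /\ 0 = Q.
Proof.
rewrite /astheno_kahler compl_dim_g compl_dim_h wedge_pow_F; last by move: nE b_gt0 nt_gt0; lia.
rewrite del_delbar_pow vertical_separation; last first.
- apply: vdegN; rewrite /Q; have bg := b_gt0.
  (* del D and delbar D together count for 2 but come with D^(b-2) at most; every other term has one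
     derivative of [D], counting for 1, and D^(b-1) at most. All stay below 2b. *)
  have two : vdeg K 2 (del J D * delbar J D) by apply: (vdegM vdelD vdelbarD).
  have mulZl (z : R[i]) (x y : cform g) : (z *: x) * y = z *: (x * y) by rewrite scalerAl.
  rewrite -!(mulrA _ (del J D)) !mulrDl !mulZl.
  have ad k : altern (del Jh (wedge_pow Ft k)).
    by have /is_pq_formP[] := pq_form_del JJh (pqFPow k).
  have adb k : altern (delbar Jh (wedge_pow Ft k)).
    by have /is_pq_formP[] := pq_form_delbar JJh (pqFPow k).
  do ![apply: vdegN|apply: vdegD|apply: vdegZ];
    (apply: vdeg_term;
     [|first [exact: ad|exact: adb|exact: aFPow]
      |first [exact: two|exact: vdelD|exact: vdelbarD|exact: vdeldelbarD]]; lia).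
- apply: alternZ; have := pq_form_del JJh (pq_form_delbar JJh (pqFPow (nt%:Z - 2))).
  by case/is_pq_formP.
split=> -[d0 Q0]; split=> //; last 2 first.
- by rewrite d0 scaler0.
- by rewrite -Q0 oppr0.
(* For nt = 1 the coefficient C(n-2, b) is zero and gives no information, but Ft^(-1) = 0 makes the
   condition on [Ft] automatic. *)
- have [nt2|nt1] := leqP 2 nt; last first.
    have -> : nt%:Z - 2 = Negz 0 by rewrite NegzE; move: nt_gt0; lia.
    by rewrite delbar0 del0.
  move/eqP: d0; rewrite scaler_eq0 pnatr_eq0 -[_ == 0%N]negbK -lt0n bin_gt0.
  have -> : (b <= n - 2)%N by move: nE; lia.
  by move/eqP.
by apply/eqP; rewrite eq_sym -oppr_eq0 Q0.
Qed.

End Equivalences.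

(** * Nilpotency and integrability pass to surjective images *)

Section SurjectiveMorphism.
Variables (R : realType) (g h : lieAlgebra R) (pi : 'Hom(g, h)).
Hypothesis pi_surj : limg pi = fullv.
Hypothesis pi_lie : forall x y, pi lie[x, y] = lie[pi x, pi y].

Lemma surj_ex (y : h) : exists x, y = pi x.
Proof.
have /memv_imgP[x _ ->] : y \in limg pi by rewrite pi_surj memvf.
by exists x.
Qed.

Lemma lower_central_img k : (lower_central h k <= pi @: lower_central g k)%VS.
Proof.
elim: k => [|k IH]; first by rewrite /= pi_surj.
apply/span_subvP => _ /allpairsP[[u v] /= [_ /vbasis_mem/(subvP IH)/memv_imgP[y yk ->] ->]].
have [x ->] := surj_ex u; rewrite -pi_lie; apply: memv_img.
by apply: mem_lie_product; rewrite ?memvf.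
Qed.

Lemma nilpotent_img : lie_nilpotent g -> lie_nilpotent h.
Proof.
case=> k k0; exists k; apply/eqP.
by rewrite -subv0 (subv_trans (lower_central_img k)) // k0 limg0.
Qed.

Lemma complex_structure_img (J : 'End(g)) (Jh : 'End(h)) :
  (forall x, pi (J x) = Jh (pi x)) -> complex_structure J -> complex_structure Jh.
Proof.
move=> pi_J [JJ NJ]; split=> [y|y y'].
  by have [x ->] := surj_ex y; rewrite -!pi_J JJ linearN.
have [x ->] := surj_ex y; have [x' ->] := surj_ex y'.
have := congr1 pi (NJ x x'); rewrite /nijenhuis !linearB /= linear0 => <-.
by rewrite !(pi_J, pi_lie).
Qed.

End SurjectiveMorphism.

(** * Central quotients *)

Section Quotient.
Variables (R : realType) (g : lieAlgebra R) (B : {vspace g}).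
Hypothesis B_cent : (B <= lie_center g)%VS.

Let U := (B^C)%VS.
Local Notation Q := (subvs_of U).

(** The quotient by [B] is realised on a linear complement [U], with the projection along [B];
    [vsval] then chooses representatives. *)
Definition quot_proj : 'Hom(g, Q) := (linfun (vsproj U) \o daddv_pi U B)%VF.

Let UB : (U :&: B = 0)%VS. Proof. by rewrite /U capvC capv_compl. Qed.
Let BU : (B :&: U = 0)%VS. Proof. by rewrite /U capv_compl. Qed.

Lemma val_quot_proj x : x - vsval (quot_proj x) \in B.
Proof.
rewrite /quot_proj comp_lfunE lfunE /= vsprojK ?memv_pi //.
have xUB : x \in (U + B)%VS by rewrite /U addvC addv_complf memvf.
by rewrite -{1}(daddv_pi_add UB xUB) addrAC subrr add0r memv_pi.
Qed.

Lemma quot_projK (y : Q) : quot_proj (vsval y) = y.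
Proof.
by rewrite /quot_proj comp_lfunE lfunE /= daddv_pi_id ?vsvalK // subvsP.
Qed.

Lemma quot_proj_surj : limg quot_proj = fullv.
Proof.
apply/vspaceP=> y; rewrite memvf.
by rewrite -(quot_projK y) memv_img ?memvf.
Qed.

Lemma quot_proj_ker : lker quot_proj = B.
Proof.
apply/vspaceP=> x; rewrite memv_ker; apply/eqP/idP=> [x0|xB].
  by have := val_quot_proj x; rewrite x0 (_ : vsval 0 = 0) ?subr0 //.
rewrite /quot_proj comp_lfunE lfunE /=.
suff -> : daddv_pi U B x = 0 by rewrite linear0.
have xUB : x \in (U + B)%VS by rewrite /U addvC addv_complf memvf.
have := daddv_pi_add UB xUB; rewrite (daddv_pi_id BU xB) => /eqP.
by rewrite -subr_eq0 addrK => /eqP.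
Qed.

Definition quot_bracket (x y : Q) : Q := quot_proj lie[vsval x, vsval y].

(** Changing a representative by an element of the central [B] does not affect brackets; the Jacobi
    identity of the quotient rests on this. *)
Lemma lie_quot_l x y : lie[vsval (quot_proj x), y] = lie[x, y].
Proof.
apply/eqP; rewrite eq_sym -subr_eq0 -(lie_mem_l B_cent y (val_quot_proj x)).
by rewrite lie_add_l lie_opp_l.
Qed.

Lemma lie_quot_r x y : lie[x, vsval (quot_proj y)] = lie[x, y].
Proof. by rewrite lie_sym lie_quot_l -lie_sym. Qed.

Lemma quot_linear_l y : linear (quot_bracket^~ y).
Proof. by move=> k u v; rewrite /quot_bracket linearP lie_linear_l linearP. Qed.

Lemma quot_linear_r x : linear (quot_bracket x).
Proof. by move=> k u v; rewrite /quot_bracket !linearP. Qed.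

Lemma quot_alternating x : quot_bracket x x = 0.
Proof. by rewrite /quot_bracket lie_alternating linear0. Qed.

Lemma quot_jacobi x y z :
  quot_bracket x (quot_bracket y z) + quot_bracket y (quot_bracket z x)
    + quot_bracket z (quot_bracket x y) = 0.
Proof. by rewrite /quot_bracket !lie_quot_r -!linearD lie_jacobi linear0. Qed.

Definition quot_lie : lieAlgebra R :=
  LieAlgebra quot_linear_l quot_linear_r quot_alternating quot_jacobi.

Definition quot_pi : 'Hom(g, quot_lie) := quot_proj.

Lemma quot_pi_lie x y : quot_pi lie[x, y] = lie[quot_pi x, quot_pi y].
Proof. by rewrite /= /quot_bracket lie_quot_l lie_quot_r. Qed.

Variable J : 'End(g).
Hypothesis JB : (J @: B <= B)%VS.

Definition quot_J : 'End(quot_lie) :=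
  (quot_proj \o J \o linfun (vsval : Q -> g))%VF.

Lemma quot_pi_J x : quot_pi (J x) = quot_J (quot_pi x).
Proof.
have : quot_proj (J (x - vsval (quot_proj x))) == 0.
  by rewrite -memv_ker quot_proj_ker (subvP JB) // memv_img // val_quot_proj.
rewrite !linearB /= subr_eq0 => /eqP H.
rewrite [RHS](_ : _ = quot_proj (J (vsval (quot_proj x)))); first exact: H.
by rewrite /quot_J comp_lfunE comp_lfunE [linfun vsval _]lfunE.
Qed.

End Quotient.

(** * A J-invariant central plane and the existence of the extension *)

Section CentralPlane.
Variables (R : realType) (g : lieAlgebra R) (J : 'End(g)).
Hypothesis JJ : forall x, J (J x) = - x.

(** [J] has no real eigenvector modulo [N]: if J e = u + k e with u in [N], applying [J] again puts
    (1 + k^2) e in [N]. *)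
Lemma J_notin_add (N : {vspace g}) e : (J @: N <= N)%VS -> e \notin N ->
  J e \notin (N + <[e]>)%VS.
Proof.
move=> JN eN; apply/negP => /memv_addP[u uN [v /vlineP[k ->] Je]].
have := congr1 J Je; rewrite JJ linearD linearZ /= Je scalerDr scalerA => H.
have : (1 + k * k) *: e \in N.
  rewrite (_ : _ *: e = - (J u + k *: u)) ?memvN ?memvD ?memvZ //.
    by rewrite (subvP JN) ?memv_img.
  have eE : e = - (J u + (k *: u + (k * k) *: e)) by rewrite -H opprK.
  by rewrite scalerDl scale1r [X in X + _]eE addrA opprD subrK.
rewrite rpredZeq (negPf eN) orbF; apply/negP.
by rewrite gt_eqF // ltr_wpDr // -expr2 sqr_ge0.
Qed.

Lemma dim_add_plane (N : {vspace g}) e : (J @: N <= N)%VS -> e \notin N ->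
  \dim (N + <[e]> + <[J e]>) = (\dim N).+2.
Proof.
move=> JN eN; have JeN := J_notin_add JN eN.
have dim_add1 (V : {vspace g}) v : v \notin V -> \dim (V + <[v]>) = (\dim V).+1.
  move=> vV; rewrite dimv_disjoint_sum ?dim_vline.
    by case: eqVneq vV => [->|]; rewrite ?mem0v // addn1.
  apply/eqP; rewrite -subv0; apply/subvP => w /memv_capP[wV /vlineP[k wE]].
  rewrite memv0; move: wV; rewrite wE rpredZeq (negPf vV) orbF => /eqP ->.
  by rewrite scale0r.
by rewrite !dim_add1.
Qed.

Lemma J_stable_plane (N : {vspace g}) e : (J @: N <= N)%VS ->
  (J @: (N + <[e]> + <[J e]>) <= N + <[e]> + <[J e]>)%VS.
Proof.
move=> JN; rewrite !limgD !limg_line JJ !subv_add; apply/andP; split; first (apply/andP; split).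
- by rewrite -addvA (subv_trans JN) // addvSl.
- exact: addvSr.
- rewrite -memvE memvN; apply: (subvP (addvSl _ _)).
  by apply: (subvP (addvSr _ _)); apply: memv_line.
Qed.

(** The ideal is the plane of x and J x for a nonzero x in a_1(J); 4 <= 2n makes it proper, and its
    dimension gives the witness nt = n - 1. *)
Lemma exists_central_extension n : \dim {:g} = (2 * n)%N -> (4 <= 2 * n)%N ->
  lie_nilpotent g -> complex_structure J -> quasi_nilpotent J ->
  exists (nt : nat) (h : lieAlgebra R) (Jh : 'End(h)) (pi : 'Hom(g, h)),
     [/\ \dim {:h} = (2 * nt)%N, lie_nilpotent h, complex_structure Jh
       & central_extension J Jh pi].
Proof.
move=> dim_g n2 nil_g cJ; rewrite /quasi_nilpotent -vpick0.
set x := vpick _ => x0.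
have /memv_capP[xZ /memv_imgP[y yZ xE]] := memv_pick (lie_center g :&: J @: lie_center g).
rewrite -/x in xZ xE.
have JxZ : J x \in lie_center g by rewrite xE JJ memvN.
have J0 : (J @: 0%VS <= (0%VS : {vspace g}))%VS by rewrite limg0.
have xN0 : x \notin (0%VS : {vspace g}) by rewrite memv0.
pose B := (0 + <[x]> + <[J x]>)%VS.
have JB : (J @: B <= B)%VS := J_stable_plane x J0.
have dB : \dim B = 2 by rewrite (dim_add_plane J0 xN0) dimv0.
have BZ : (B <= lie_center g)%VS.
  by rewrite !subv_add sub0v -!memvE xZ JxZ.
pose pi := quot_pi BZ.
have pi_surj : limg pi = fullv := quot_proj_surj B.
have pi_lie := quot_pi_lie BZ.
have pi_J := quot_pi_J BZ JB.
exists n.-1, (quot_lie BZ), (quot_J BZ J), pi; split.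
- have := limg_ker_dim pi fullv; rewrite capfv pi_surj (quot_proj_ker B) dB dim_g.
  by lia.
- exact: (nilpotent_img pi_surj pi_lie).
- exact: (complex_structure_img pi_surj pi_lie pi_J).
split; last by split.
exists B; split=> //; last 2 first.
- split; first by rewrite -dimv_eq0 dB.
  by apply: contraTneq n2 => BT; rewrite -dim_g -BT dB.
- exact: quot_proj_ker.
by move=> u v vB; rewrite (lie_mem_r BZ) // mem0v.
Qed.

End CentralPlane.

(** * Forms of degree one and two *)

Section LowDegree.
Variables (R : realType) (g : lieAlgebra R).
Implicit Types (a b f : cform g) (x y u v : g).

Lemma homog1P a : altern a /\ homog 1 a <-> homog 1 a /\
  forall (k : R) x y, a [:: k *: x + y] = (k%:C)%C * a [:: x] + a [:: y].
Proof.
split=> [[aa ha]|[ha la]]; first by split=> // k x y; apply: (aa.1 [::] [::]).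
split=> //; split=> [s1 s2 k u v|s1 s2 u].
  case: s1 s2 => [|? [|? s1]] [|? s2]; rewrite ?la //; rewrite !ha ?mulr0 ?addr0 //.
by rewrite ha // size_cat /= !addnS.
Qed.

Lemma mul11 a b x y : homog 1 a -> homog 1 b ->
  (a * b) [:: x; y] = a [:: x] * b [:: y] - a [:: y] * b [:: x].
Proof.
move=> ha hb; rewrite !mul_cons !mul_nil /parity /contract /=.
by rewrite [a [::]]ha // [a [:: x; y]]ha // [b [::]]hb // [b [:: x; y]]hb //; ring.
Qed.

Lemma homog1_ext a b : homog 1 a -> homog 1 b -> (forall x, a [:: x] = b [:: x]) -> a = b.
Proof.
move=> ha hb ab; apply/funext=> s; have [s1|s1] := eqVneq (size s) 1%N.
  by case: s s1 => [|x []].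
by rewrite ha // hb.
Qed.

Lemma homog2_ext a b : homog 2 a -> homog 2 b ->
  (forall x y, a [:: x; y] = b [:: x; y]) -> a = b.
Proof.
move=> ha hb ab; apply/funext=> s; have [s1|s1] := eqVneq (size s) 2%N.
  by case: s s1 => [|x [|y []]].
by rewrite ha // hb.
Qed.

Lemma altern2C f x y : altern f -> f [:: x; y] = - f [:: y; x].
Proof. by move=> af; apply: (altern_swap [::] [::]). Qed.

Lemma altern2D f x y u v : altern f ->
  f [:: x + y; u + v] = f [:: x; u] + f [:: x; v] + f [:: y; u] + f [:: y; v].
Proof.
move=> af; have D1 p q r : f [:: p + q; r] = f [:: p; r] + f [:: q; r].
  exact: (congr1 (fun a : cform g => a [:: r]) (mlin_headD p q af.1)).
rewrite D1 !(altern2C _ (u + v) af) !D1 !opprD -!(altern2C _ _ af).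
by ring.
Qed.

Lemma dform1 f x y : altern f -> dform f [:: x; y] = - f [:: lie[x, y]].
Proof.
move=> af; rewrite dform_cons // lie_der_cons dform_cons; last exact: altern_contract.
by rewrite dform_nil /lie_der /= /contract; ring.
Qed.

Lemma homog_conj k f : homog k f -> homog k (conj_form f).
Proof. by move=> hf s sk; rewrite /conj_form hf // conjc0. Qed.

Lemma altern_conj f : altern f -> altern (conj_form f).
Proof.
move=> [lf af]; split=> [s1 s2 k u v|s1 s2 u]; rewrite /conj_form.
  by rewrite lf rmorphD rmorphM /= oppr0.
by rewrite af conjc0.
Qed.

Lemma conj_formK : involutive (@conj_form R g).
Proof. by move=> f; apply/funext=> s; rewrite /conj_form conjcK. Qed.

End LowDegree.

(** * Types in low degree and integrability *)

Section LowTypes.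
Variables (R : realType) (g : lieAlgebra R) (J : 'End(g)).
Hypothesis JJ : forall x, J (J x) = - x.
Implicit Types (a b f : cform g) (x y u v : g).

Let ii2 : 'i%C * 'i%C = -1 :> R[i]. Proof. by rewrite -expr2 sqr_i. Qed.

Lemma type10E f v : type_comp J 1 0 f [:: v] = contract10 J v f [::].
Proof. by rewrite type_comp_cons [type_comp J 1 _ _]type_comp_lt0 // cform0 addr0. Qed.

Lemma type01E f v : type_comp J 0 1 f [:: v] = contract01 J v f [::].
Proof. by rewrite type_comp_cons [type_comp J _ 1 _]type_comp_lt0 // cform0 add0r. Qed.

Lemma form10P a : is_pq_form J 1 0 a <->
  [/\ altern a, homog 1 a & forall x, a [:: J x] = 'i%C * a [:: x]].
Proof.
split=> [pa|[aa ha Ja]].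
  have [/is_formP[aa ha] _] := pa; have /is_pq_formP[_ ta] := pa; split=> // x.
  have E y : a [:: y] = contract10 J y a [::] by rewrite -type10E ta.
  by rewrite [LHS]E (contract10J JJ) ?cformZ -?E //; case: aa.
apply/is_pq_formP; split=> //; apply: homog1_ext => // [s|x].
  by move=> s1; rewrite type_comp_homog.
rewrite type10E /contract10 !(cformZ, cformD, cformN) /contract Ja.
by field: ii2.
Qed.

Lemma form01_conj a : is_pq_form J 1 0 a -> is_pq_form J 0 1 (conj_form a).
Proof.
case/form10P=> aa ha Ja; apply/is_pq_formP; split; first exact: altern_conj.
apply: homog1_ext; [by move=> s s1; rewrite type_comp_homog|exact: homog_conj|].
move=> x; rewrite type01E /contract01 !(cformZ, cformD, cformN) /contract /conj_form Ja.
have -> : ('i%C * a [:: x])^*%C = - 'i%C * (a [:: x])^*%C.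
  by rewrite rmorphM; congr (_ * _); apply/eqP; rewrite eq_complex /= oppr0 !eqxx.
by field: ii2.
Qed.

Lemma form10_conj a : is_pq_form J 0 1 a -> is_pq_form J 1 0 (conj_form a).
Proof.
move=> pa; have [/is_formP[aa ha] _] := pa; have /is_pq_formP[_ ta] := pa.
apply/form10P; split; [exact: altern_conj|exact: homog_conj|move=> x].
have E y : a [:: y] = contract01 J y a [::] by rewrite -type01E ta.
rewrite /conj_form [a [:: J x]]E (contract01J JJ); last by case: aa.
rewrite cformZ -E rmorphM.
by congr (_ * _); apply/eqP; rewrite eq_complex /= opprK oppr0 !eqxx.
Qed.

Lemma homog1_split a : homog 1 a -> a = type_comp J 1 0 a + type_comp J 0 1 a.
Proof.
move=> ha; apply: homog1_ext => //.
  by apply: homogD => s s1; rewrite type_comp_homog.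
by move=> x; rewrite cformD type10E type01E -cformD -contract_split.
Qed.

Lemma homog2_split f : homog 2 f ->
  f = type_comp J 2 0 f + type_comp J 1 1 f + type_comp J 0 2 f.
Proof.
move=> ha; apply: homog2_ext => //.
  by do 2?apply: homogD; move=> s s1; rewrite type_comp_homog.
have h1 x : homog 1 (contract x f) by apply: (@homog_contract _ _ 2).
have h10 x : homog 1 (contract10 J x f).
  by apply: homogZ; apply: homogD => //; rewrite -scaleN1r; do 2!apply: homogZ.
have h01 x : homog 1 (contract01 J x f).
  by apply: homogZ; apply: homogD => //; apply: homogZ.
move=> x y; rewrite -[LHS]/(contract x f [:: y]) (contract_split J) cformD.
rewrite (homog1_split (h10 x)) (homog1_split (h01 x)) !cformD.
rewrite -![type_comp J _ _ f [:: x; y]]/(contract x (type_comp J _ _ f) [:: y]).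
rewrite !contract_type_comp !cformD.
rewrite ![type_comp J (0 - 1) _ _]type_comp_lt0 // ![type_comp J _ (0 - 1) _]type_comp_lt0 //.
by rewrite !cform0 addr0 add0r !addrA.
Qed.

(** The (0,2) component of d a at (x, y) is a quarter of the value of [a] on the Nijenhuis
    tensor. *)
Lemma dform10_type a : (forall x y, nijenhuis J x y = 0) -> is_pq_form J 1 0 a ->
  type_comp J 0 2 (dform a) = 0.
Proof.
move=> NJ /form10P[aa ha Ja].
have ada := altern_dform aa; have hda := homog_dform aa ha.
apply: homog2_ext => //; first by move=> s s1; rewrite type_comp_homog.
move=> x y; rewrite cform0 type_comp_cons [type_comp J (0 - 1) _ _]type_comp_lt0 //.
rewrite cform0 add0r (_ : 2 - 1 = 1 :> int) // type01E.
rewrite /contract01 /contract !(cformZ, cformD, cformN) !dform1 //.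
have := congr1 (fun v => a [:: v]) (NJ x y); rewrite /nijenhuis.
have lin p q : a [:: p + q] = a [:: p] + a [:: q].
  exact: (congr1 (fun a : cform g => a [::]) (mlin_headD p q aa.1)).
have linN p : a [:: - p] = - a [:: p].
  exact: (congr1 (fun a : cform g => a [::]) (mlin_headN p aa.1)).
rewrite !(lin, linN, Ja).
have -> : a [:: 0] = 0 by exact: (congr1 (fun a : cform g => a [::]) (mlin_head0 aa.1)).
by move/eqP; rewrite !subr_eq add0r => /eqP ->; field: ii2.
Qed.

End LowTypes.

(** * Unitary coframes and adapted bases *)

Section UnitaryCoframe.
Variables (R : realType) (g : lieAlgebra R) (J : 'End(g)).
Hypothesis JJ : forall x, J (J x) = - x.
Implicit Types (a b f F : cform g) (x y u v e : g) (N K : {vspace g}).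

Let ii2 : 'i%C * 'i%C = -1 :> R[i]. Proof. by rewrite -expr2 sqr_i. Qed.

(** A positive semi-definite form whose radical is exactly [N]: a Hermitian metric for N = 0, and a
    form that descends to a metric on the base for N = ker pi. The construction moves from the first
    to the second. *)
Definition semi_hermitian N F :=
  [/\ is_pq_form J 1 1 F, conj_form F = F,
      forall v y, v \in N -> F [:: v; y] = 0 &
      forall v, v \notin N -> 0 < F [:: v; J v]].

Definition square_form a : cform g := ('i%C / 2%:R) *: (a * conj_form a).

Lemma square_formE a x y : homog 1 a ->
  square_form a [:: x; y]
  = 'i%C / 2%:R * (a [:: x] * (a [:: y])^*%C - a [:: y] * (a [:: x])^*%C).
Proof. by move=> ha; rewrite /square_form cformZ mul11 //; apply: homog_conj. Qed.

Lemma conji : ('i%C)^*%C = - 'i%C :> R[i].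
Proof. by apply/eqP; rewrite eq_complex /= oppr0 !eqxx. Qed.

Lemma conjcM (z t : R[i]) : (z * t)^*%C = z^*%C * t^*%C.
Proof. exact: (rmorphM (@conjc R)). Qed.
Lemma conjcB (z t : R[i]) : (z - t)^*%C = z^*%C - t^*%C.
Proof. exact: (rmorphB (@conjc R)). Qed.

Lemma conj_add_cform a b : conj_form (a + b) = conj_form a + conj_form b.
Proof. by apply/funext=> s; rewrite /conj_form cformD rmorphD. Qed.

Lemma conj_opp_cform a : conj_form (- a) = - conj_form a.
Proof. by apply/funext=> s; rewrite /conj_form cformN rmorphN. Qed.

Lemma square_form_pq a : is_pq_form J 1 0 a -> is_pq_form J 1 1 (square_form a).
Proof.
move=> pa; apply: pq_formZ.
by have := pq_form_mul JJ pa (form01_conj JJ pa).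
Qed.

Lemma square_form_real a : is_pq_form J 1 0 a -> conj_form (square_form a) = square_form a.
Proof.
move=> pa; have [/is_formP[_ h2] _] := square_form_pq pa.
have [/is_formP[_ ha] _] := pa.
apply: homog2_ext => //; first exact: homog_conj.
move=> x y; rewrite {1}/conj_form !square_formE // !(conjcM, conjcB) !conjcK conji.
by rewrite conjc_inv conjc_nat; ring.
Qed.

Lemma pq_formB (p q : nat) a b : is_pq_form J p q a -> is_pq_form J p q b ->
  is_pq_form J p q (a - b).
Proof. by move=> pa pb; rewrite -scaleN1r; apply: pq_formD => //; apply: pq_formZ. Qed.

(** The Hermitian product with [e]: with the metric g(x, y) = F(x, J y), this is g - i F at (x, e),
    complex linear in x. *)
Definition unitary_form F e : cform g := fun s =>
  if s is [:: x] then F [:: x; J e] - 'i%C * F [:: x; e] else 0.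

Lemma form11N F x y : is_pq_form J 1 1 F -> F [:: J x; y] = - F [:: x; J y].
Proof.
move=> pF; have /is_pq_formP[aF _] := pF; rewrite -(form11_J JJ pF (J x)) JJ.
exact: (congr1 (fun a : cform g => a [:: J y]) (mlin_headN x aF.1)).
Qed.

Lemma unitary_form_pq F e : is_pq_form J 1 1 F -> is_pq_form J 1 0 (unitary_form F e).
Proof.
move=> pF; have /is_pq_formP[aF _] := pF; apply/form10P => //.
have hu : homog 1 (unitary_form F e) by case=> [|? []].
have [] := (homog1P (unitary_form F e)).2.
  split=> // k x y /=.
  have lin z : F [:: k *: x + y; z] = (k%:C)%C * F [:: x; z] + F [:: y; z].
    exact: (aF.1 [::] [:: z]).
  by rewrite !lin; ring.
move=> au _; split=> // x /=.
rewrite (form11_J JJ pF) (form11N _ _ pF).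
by ring: ii2.
Qed.

Lemma form1_lin a (k l : R) x y z : altern a ->
  a [:: x - (k *: y + l *: z)] = a [:: x] - (k%:C%C * a [:: y] + l%:C%C * a [:: z]).
Proof.
move=> aa; have la := aa.1; rewrite -[LHS]/(contract _ a [::]).
by rewrite mlin_headD // mlin_headN // mlin_head // mlin_headZ.
Qed.

Lemma semi_hermitian_subr N F e : (J @: N <= N)%VS -> semi_hermitian N F ->
  F [:: e; J e] = 1 -> semi_hermitian (N + <[e]> + <[J e]>) (F - square_form (unitary_form F e)).
Proof.
move=> JN [pF rF radF posF] e1; set t := unitary_form F e.
have pt : is_pq_form J 1 0 t by apply: unitary_form_pq.
have /form10P -/(_ JJ) [at_ ht Jt] := pt.
have /is_pq_formP[aF _] := pF.
have Fee : F [:: e; e] = 0 by apply: (aF.2 [::]).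
have te : t [:: e] = 1 by rewrite /t /= e1 Fee mulr0 subr0.
have pF' : is_pq_form J 1 1 (F - square_form t) by apply: pq_formB => //; apply: square_form_pq.
set F' := F - square_form t in pF' *.
have /is_pq_formP[aF' _] := pF'.
have F'E x y : F' [:: x; y] = F [:: x; y]
    - 'i%C / 2%:R * (t [:: x] * (t [:: y])^*%C - t [:: y] * (t [:: x])^*%C).
  by rewrite /F' cformD cformN square_formE.
have tN v : v \in N -> t [:: v] = 0 by move=> vN; rewrite /t /= !radF // mulr0 subr0.
have radN v y : v \in N -> F' [:: v; y] = 0.
  by move=> vN; rewrite F'E radF // tN // conjc0 mul0r mulr0 subr0 mulr0 subr0.
have Fconj x y : (F [:: x; y])^*%C = F [:: x; y].
  exact: (congr1 (fun a : cform g => a [:: x; y]) rF).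
(* As t(e) = 1 and t(y) has imaginary part -F(y, e), the square takes the value F(e, y) at (e,
   y). *)
have rade y : F' [:: e; y] = 0.
  rewrite F'E te conjc1 mul1r mulr1 /t /= conjcB conjcM conji !Fconj (altern2C e y aF).
  by field: ii2.
have radJe y : F' [:: J e; y] = 0 by rewrite (form11N _ _ pF') rade oppr0.
have rad v y : v \in (N + <[e]> + <[J e]>)%VS -> F' [:: v; y] = 0.
  case/memv_addP=> v1 /memv_addP[v2 v2N [_ /vlineP[k ->] ->]] [_ /vlineP[l ->] ->].
  have lF' := aF'.1; rewrite -[LHS]/(contract _ F' [:: y]).
  rewrite !mlin_headD // !mlin_headZ // !(cformD, cformZ) /contract.
  by rewrite radN // rade radJe !mulr0 !addr0.
split=> //.
  by rewrite conj_add_cform conj_opp_cform rF square_form_real.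
(* [w] is the component of [v] in the plane of e and J e. It lies in the new radical and t(v - w) =
   0, so F'(v, J v) = F(v - w, J (v - w)) > 0. *)
move=> v vN'; pose c := t [:: v].
pose w := complex.Re c *: e + complex.Im c *: J e.
have wN' : w \in (N + <[e]> + <[J e]>)%VS.
  apply: memv_add; last by apply: memvZ; apply: memv_line.
  by rewrite -[_ *: e]add0r memv_add ?mem0v // memvZ // memv_line.
have JwN' : J w \in (N + <[e]> + <[J e]>)%VS.
  by apply: (subvP (J_stable_plane JJ e JN)); apply: memv_img.
have tv' : t [:: v - w] = 0.
  rewrite /w form1_lin // Jt te mulr1 mulr1 -/c [X in X - _]complexE.
  by rewrite [_ * 'i%C]mulrC subrr.
have v'N : v - w \notin N.
  apply: contra vN' => v'N; rewrite -[v](subrK w) memvD //.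
  by apply: (subvP _ _ v'N); rewrite -addvA addvSl.
have -> : F' [:: v; J v] = F' [:: (v - w) + w; J (v - w) + J w].
  by rewrite -linearD !subrK.
have z1 : F' [:: v - w; J w] = 0 by rewrite altern2C // rad // oppr0.
rewrite altern2D // z1 !(rad w _ wN') !addr0 F'E Jt tv' mulr0 conjc0 !mul0r subr0 mulr0 subr0.
exact: posF.
Qed.

Lemma exists_unitary_vector N F e0 : semi_hermitian N F -> e0 \notin N ->
  exists2 k : R, k != 0 & F [:: k *: e0; J (k *: e0)] = 1.
Proof.
move=> [pF rF _ posF] /posF; rewrite (real_formE rF) ltcR => c0.
set c := complex.Re _ in c0 *.
have /is_pq_formP[aF _] := pF.
have sc0 : Num.sqrt c != 0 by rewrite gt_eqF // sqrtr_gt0.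
exists (Num.sqrt c)^-1; first by rewrite invr_neq0.
have lF := aF.1; rewrite linearZ /= -[LHS]/(contract _ F [:: _]) mlin_headZ // cformZ /contract.
rewrite (altern2C _ _ aF) -[F _]/(contract _ F [:: _]) mlin_headZ // cformZ /contract.
rewrite -mulrN -(altern2C _ _ aF) (real_formE rF) -/c -!rmorphM /=.
rewrite -{3}(sqr_sqrtr (ltW c0)) expr2 mulKf // mulVf //.
Qed.

(** The last two conclusions say that the first m forms restrict to a basis of the restrictions to
    [K] of the (1,0)-forms vanishing on [N]; they become the vertical half of the adapted basis.
    Indexing by [nat] lets the induction prepend a form. *)
Lemma unitary_coframe m N K F : semi_hermitian N F -> (J @: N <= N)%VS ->
  (J @: K <= K)%VS -> (N <= K)%VS -> \dim K = (\dim N + 2 * m)%N ->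
  exists th : nat -> cform g,
  [/\ forall k, is_pq_form J 1 0 (th k),
      forall k v, v \in N -> th k [:: v] = 0,
      semi_hermitian K (F - \sum_(k < m) square_form (th k)),
      forall a, is_pq_form J 1 0 a -> (forall v, v \in N -> a [:: v] = 0) ->
        exists c : nat -> R[i], forall v, v \in K ->
          a [:: v] = \sum_(k < m) c k * th k [:: v] &
      forall c : nat -> R[i],
        (forall v, v \in K -> \sum_(k < m) c k * th k [:: v] = 0) ->
        forall k, (k < m)%N -> c k = 0].
Proof.
elim: m N F => [|m IH] N F sF JN JK NK dK.
  have KN : K = N by apply/eqP; rewrite eq_sym eqEdim NK dK addn0 leqnn.
  exists (fun=> 0); split=> //.
  - by move=> _; apply: pq_form0.
  - by rewrite big_ord0 subr0 KN.
  - by move=> a _ a0; exists (fun=> 0) => v vK; rewrite big_ord0 a0 // -KN.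
have /subvPn[e0 e0K e0N] : ~~ (K <= N)%VS.
  by apply/negP => /dimvS; rewrite dK; lia.
have [e [eK eN e1]] : exists e, [/\ e \in K, e \notin N & F [:: e; J e] = 1].
  have [k k0 e1] := exists_unitary_vector sF e0N; exists (k *: e0); split=> //.
    exact: memvZ.
  by rewrite rpredZeq negb_or k0.
have JeK : J e \in K by apply: (subvP JK); apply: memv_img.
have sF' := semi_hermitian_subr JN sF e1.
set t := unitary_form F e in sF'; have [pF rF radF posF] := sF.
have pt : is_pq_form J 1 0 t by apply: unitary_form_pq.
have /form10P -/(_ JJ) [at_ ht Jt] := pt.
have tN v : v \in N -> t [:: v] = 0 by move=> vN; rewrite /t /= !radF // mulr0 subr0.
have /is_pq_formP[aF _] := pF.
have te : t [:: e] = 1 by rewrite /t /= e1 (aF.2 [::]) mulr0 subr0.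
clearbody t; set N' := (N + <[e]> + <[J e]>)%VS in sF'.
have NN' : (N <= N')%VS by rewrite /N' -addvA addvSl.
have eN' : e \in N'.
  by apply: (subvP (addvSl _ _)); apply: (subvP (addvSr _ _)); apply: memv_line.
have [||||th [pth thN' sth exth unth]] := IH N' _ sF'.
- exact: J_stable_plane.
- exact: JK.
- by rewrite !subv_add NK -!memvE eK JeK.
- by rewrite dK (dim_add_plane JJ JN eN); lia.
pose th' k := if k is k'.+1 then th k' else t.
exists th'; split=> //.
- by case.
- by case=> [|l] v vN; [exact: tN | apply: thN'; apply: (subvP NN')].
- by rewrite big_ord_recl /= opprD addrA.
- move=> a pa aN.
  (* Subtracting a(e) t gives a form that vanishes on [N] and at [e], hence at J e by its type, as
     the induction hypothesis for [N'] requires. *)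
  have pa' : is_pq_form J 1 0 (a - a [:: e] *: t) by apply: pq_formB => //; apply: pq_formZ.
  have /form10P -/(_ JJ) [aa' ha' Ja'] := pa'.
  have [|c cE] := exth _ pa'.
    move=> v /memv_addP[v1 /memv_addP[v2 v2N [_ /vlineP[l ->] ->]] [_ /vlineP[r ->] ->]].
    have la' := aa'.1; rewrite -[LHS]/(contract _ _ [::]).
    rewrite !mlin_headD // !mlin_headZ // !(cformD, cformZ) /contract Ja'.
    by rewrite !(cformD, cformN, cformZ) aN // tN // te; ring.
  exists (fun k => if k is k'.+1 then c k' else a [:: e]) => v vK.
  by rewrite big_ord_recl /= -(cE v vK) !(cformD, cformN, cformZ) addrC subrK.
(* At [e] the later forms vanish, since [e] lies in [N'], while t(e) = 1. *)
move=> c cE; have c0 : c 0%N = 0.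
  have := cE e eK; rewrite big_ord_recl /= te mulr1 big1 ?addr0 // => i _.
  by rewrite thN' // mulr0.
case=> [|l] // lm; apply: (unth (fun k => c k.+1)) => // v vK.
by have := cE v vK; rewrite big_ord_recl /= c0 mul0r add0r.
Qed.

End UnitaryCoframe.

Lemma big_ord_cat (V : nmodType) (m n : nat) (G : nat -> V) : (m <= n)%N ->
  \sum_(k < n) G k = \sum_(k < m) G k + \sum_(k < n - m) G (m + k)%N.
Proof.
move=> mn; rewrite -(big_mkord xpredT G) (big_cat_nat _ mn) //= big_mkord.
congr (_ + _); rewrite -{1}[m]add0n big_addn big_mkord.
by apply: eq_bigr => i _; rewrite addnC.
Qed.

Lemma big_ord_geq (V : nmodType) (m n : nat) (G : nat -> V) : (m <= n)%N ->
  \sum_(k < n | (m <= k)%N) G k = \sum_(k < n - m) G (m + k)%N.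
Proof.
move=> mn; rewrite big_mkcond (big_ord_cat (fun k => if (m <= k)%N then G k else 0) mn).
rewrite big1 ?add0r => [|i _]; last by rewrite leqNgt ltn_ord.
by apply: eq_bigr => i _; rewrite leq_addr.
Qed.

(** * Two-forms expressed by a (1,0)-basis and its conjugates *)

Section Wedge2Span.
Variables (R : realType) (h : lieAlgebra R) (J : 'End(h)) (m : nat).
Variable wt : 'I_m -> cform h.
Hypothesis JJ : forall x, J (J x) = - x.
Hypothesis wtB : basis_10 J wt.
Implicit Types (a f : cform h).

Let t (x : 'I_m + 'I_m) : cform h :=
  match x with inl l => wt l | inr l => conj_form (wt l) end.

Lemma conj_sum_cform (I : finType) (c : I -> R[i]) (f : I -> cform h) :
  conj_form (\sum_i c i *: f i) = \sum_i (c i)^*%C *: conj_form (f i).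
Proof.
apply/funext=> s; rewrite /conj_form !cform_sum.
rewrite (big_morph (@conjc R) (rmorphD (@conjc R)) (rmorph0 (@conjc R))).
by apply: eq_bigr => i _; rewrite !cformZ conjcM.
Qed.

(** The (0,1) component is the conjugate of a (1,0)-form, which is expanded and conjugated back. *)
Lemma one_form_span a : altern a -> homog 1 a ->
  exists c : 'I_m + 'I_m -> R[i], a = \sum_x c x *: t x.
Proof.
move=> aa ha; have [_ spanB] := wtB.
have p10 : is_pq_form J 1 0 (type_comp J 1 0 a) by apply: pq_form_type_comp.
have p01 : is_pq_form J 0 1 (type_comp J 0 1 a) by apply: pq_form_type_comp.
have [c1 [E1 _]] := spanB _ p10; have [c2 [E2 _]] := spanB _ (form10_conj JJ p01).
exists (fun x => match x with inl l => c1 l | inr l => (c2 l)^*%C end).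
rewrite big_sumType /= -E1 -conj_sum_cform -E2 conj_formK.
exact: homog1_split.
Qed.

Lemma wedge2_span0 : in_wedge2_span t 0.
Proof.
exists (fun _ _ => 0); rewrite big1 // => x _; rewrite big1 // => y _.
by rewrite scale0r.
Qed.

Lemma wedge2_spanD f1 f2 : in_wedge2_span t f1 -> in_wedge2_span t f2 ->
  in_wedge2_span t (f1 + f2).
Proof.
move=> [c1 ->] [c2 ->]; exists (fun x y => c1 x y + c2 x y).
rewrite -big_split; apply: eq_bigr => x _; rewrite -big_split; apply: eq_bigr => y _ /=.
by rewrite scalerDl.
Qed.

Lemma wedge2_spanZ z f : in_wedge2_span t f -> in_wedge2_span t (z *: f).
Proof.
move=> [c ->]; exists (fun x y => z * c x y).
rewrite scaler_sumr; apply: eq_bigr => x _; rewrite scaler_sumr; apply: eq_bigr => y _.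
by rewrite scalerA.
Qed.

Lemma wedge2_spanM a1 a2 : altern a1 -> homog 1 a1 -> altern a2 -> homog 1 a2 ->
  in_wedge2_span t (a1 * a2).
Proof.
move=> aa1 h1 aa2 h2; have [c1 ->] := one_form_span aa1 h1.
have [c2 ->] := one_form_span aa2 h2; exists (fun x y => c1 x * c2 y).
rewrite mulr_suml; apply: eq_bigr => x _; rewrite mulr_sumr; apply: eq_bigr => y _.
by rewrite -scalerAl -scalerAr scalerA wedgeE.
Qed.

Let X := vbasis {:h}.
Definition coord_form i : cform h := fun s =>
  if s is [:: x] then ((coord X i x)%:C)%C else 0.

Lemma coord_form_altern i : altern (coord_form i) /\ homog 1 (coord_form i).
Proof.
apply/homog1P; split=> [[|? []] //|k x y] /=.
by rewrite linearP rmorphD rmorphM.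
Qed.

(** [f] is half the sum of f(X_i, X_j) x_i ^ x_j over real coordinate forms, since each pair occurs
    in both orders; then every x_i is expanded on the [t x]. *)
Lemma two_form_span f : altern f -> homog 2 f -> in_wedge2_span t f.
Proof.
move=> af hf.
have -> : f = \sum_(i < \dim {:h}) \sum_(j < \dim {:h})
    (f [:: X`_i; X`_j] / 2%:R) *: (coord_form i * coord_form j).
  apply: homog2_ext => //.
    move=> s s2; rewrite cform_sum big1 // => i _; rewrite cform_sum big1 // => j _.
    have [[_ hi] [_ hj]] := (coord_form_altern i, coord_form_altern j).
    by rewrite cformZ (homogM hi hj) ?mulr0.
  have fE x y : f [:: x; y] = \sum_i \sum_j
      (coord X i x)%:C%C * (coord X j y)%:C%C * f [:: X`_i; X`_j].
    rewrite {1}(coord_vbasis (memvf x)) -[LHS]/(contract _ f [:: y]).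
    rewrite mlin_head_sum; last by case: af.
    rewrite cform_sum; apply: eq_bigr => i _; rewrite cformZ /contract.
    rewrite (altern2C _ _ af) {1}(coord_vbasis (memvf y)) -[f _]/(contract _ f [:: X`_i]).
    rewrite mlin_head_sum; last by case: af.
    rewrite cform_sum -sumrN mulr_sumr; apply: eq_bigr => j _.
    by rewrite cformZ /contract -mulrN -(altern2C _ _ af) mulrA.
  move=> x y; have -> : f [:: x; y] = (f [:: x; y] - f [:: y; x]) / 2%:R.
    by rewrite (altern2C y x af); field.
  rewrite !fE -sumrB mulr_suml cform_sum; apply: eq_bigr => i _.
  rewrite -sumrB mulr_suml cform_sum; apply: eq_bigr => j _.
  have [[_ hi] [_ hj]] := (coord_form_altern i, coord_form_altern j).
  by rewrite cformZ mul11 //=; ring.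
apply: (big_ind (in_wedge2_span t) wedge2_span0 wedge2_spanD) => i _.
apply: (big_ind (in_wedge2_span t) wedge2_span0 wedge2_spanD) => j _.
apply: wedge2_spanZ; have [[ai hi] [aj hj]] := (coord_form_altern i, coord_form_altern j).
exact: wedge2_spanM.
Qed.

End Wedge2Span.

(** * Existence of the metric on the base and of adapted bases *)

Section AdaptedBasis.
Variables (R : realType) (g h : lieAlgebra R) (J : 'End(g)) (Jh : 'End(h)).
Variables (pi : 'Hom(g, h)) (n nt : nat) (F : cform g).
Hypothesis cJ : complex_structure J.
Hypothesis cJh : complex_structure Jh.
Hypothesis dim_g : \dim {:g} = (2 * n)%N.
Hypothesis dim_h : \dim {:h} = (2 * nt)%N.
Hypothesis K_cent : (lker pi <= lie_center g)%VS.
Hypothesis K_J : (J @: lker pi <= lker pi)%VS.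
Hypothesis pi_surj : limg pi = fullv.
Hypothesis pi_lie : forall x y, pi lie[x, y] = lie[pi x, pi y].
Hypothesis pi_J : forall x, pi (J x) = Jh (pi x).
Hypothesis hF : hermitian_metric J F.

Local Notation K := (lker pi).
Let JJ := cJ.1.
Let JJh := cJh.1.

(** A linear section of [pi], used to write down the form on [h] to which a form with [K] in its
    radical descends. *)
Let sg : 'Hom(h, g) := (pi^-1)%VF.

Let piK y : pi (sg y) = y.
Proof. by apply: limg_lfunVK; rewrite pi_surj memvf. Qed.

Let sgK x : x - sg (pi x) \in K.
Proof. by rewrite memv_ker linearB /= piK subrr. Qed.

Let nt_le_n : (nt <= n)%N.
Proof.
have := limg_ker_dim pi fullv; rewrite capfv pi_surj dim_g dim_h; lia.
Qed.

Lemma descent1 (a : cform g) : altern a -> homog 1 a ->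
  (forall v, v \in K -> a [:: v] = 0) -> pullback pi (pullback sg a) = a.
Proof.
move=> aa ha aK; apply: homog1_ext => //; first by do 2!apply: homog_pullback.
move=> x; rewrite /pullback /=; apply/eqP; rewrite -subr_eq0 -oppr_eq0 opprB.
have <- : a [:: x - sg (pi x)] = a [:: x] - a [:: sg (pi x)].
  have la := aa.1; rewrite -[LHS]/(contract _ a [::]) mlin_headD // mlin_headN //.
by rewrite aK.
Qed.

Lemma descent2 (a : cform g) : altern a -> homog 2 a ->
  (forall v y, v \in K -> a [:: v; y] = 0) -> pullback pi (pullback sg a) = a.
Proof.
move=> aa ha aK; apply: homog2_ext => //; first by do 2!apply: homog_pullback.
move=> x y; rewrite /pullback /=.
rewrite -{2}(subrK (sg (pi x)) x) -{2}(subrK (sg (pi y)) y) altern2D //.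
by rewrite !(aK _ _ (sgK x)) (altern2C _ (y - _) aa) (aK _ _ (sgK y)) oppr0 !add0r.
Qed.

Lemma pq_form_descent (p q : nat) (a : cform g) (b : cform h) :
  is_pq_form J p q a -> altern b -> pullback pi b = a -> is_pq_form Jh p q b.
Proof.
move=> /is_pq_formP[aa ta] ab bE; apply/is_pq_formP; split=> //.
by apply: (pullback_inj pi_surj); rewrite -(type_comp_pullback pi_J) bE ta.
Qed.

Lemma exists_adapted_basis : exists Ft : cform h,
  hermitian_metric Jh Ft /\
  forall wt : 'I_nt -> cform h, basis_10 Jh wt ->
    exists w : 'I_n -> cform g,
      adapted_basis J pi wt w /\ F = pullback pi Ft + vertical_form nt w.
Proof.
have [pF rF posF] := hF.
have sF : semi_hermitian J 0%VS F.
  split=> // v; last by rewrite memv0; apply: posF.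
  move=> y; rewrite memv0 => /eqP ->; apply: mlin_mem0; last by rewrite mem_head.
  by have /is_pq_formP[[]] := pF.
have J0 : (J @: 0%VS <= (0%VS : {vspace g}))%VS by rewrite limg0.
have dK : \dim K = (\dim (0%VS : {vspace g}) + 2 * (n - nt))%N.
  by rewrite dimv0 add0n (dim_ker dim_g dim_h pi_surj).
(* [Ft] will depend only on this coframe, so it is fixed before [wt] is given. *)
have [th [pth _ sF' exth unth]] := unitary_coframe JJ sF J0 K_J (sub0v K) dK.
set F' := F - _ in sF'; have [pF' rF' radF' posF'] := sF'.
have [/is_formP[aF' hF'] _] := pF'.
pose Ft := pullback sg F'.
have FtE : pullback pi Ft = F' by apply: descent2.
have aFt : altern Ft by apply: altern_pullback.
exists Ft; split.
  split; first exact: (pq_form_descent pF' aFt FtE).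
    by apply/funext=> s; apply: (congr1 (fun a : cform g => a (map sg s)) rF').
  move=> y y0; have [x yE] := surj_ex pi_surj y.
  have -> : Ft [:: y; Jh y] = pullback pi Ft [:: x; J x] by rewrite /pullback /= pi_J yE.
  by rewrite FtE posF' // memv_ker -yE.
move=> wt wtB; have [pwt spanwt] := wtB.
(* Indices below nt carry the pulled back basis, the others the coframe shifted by nt; a function on
   [nat] allows sums to be cut at nt. *)
pose W k := if insub k is Some l then pullback pi (wt l) else th (k - nt)%N.
have W1 (l : 'I_nt) : W l = pullback pi (wt l) by rewrite /W valK.
have W2 k : W (nt + k)%N = th k.
  by rewrite /W insubF ?addKn //; apply/negbTE; rewrite -leqNgt leq_addr.
have pW k : is_pq_form J 1 0 (W k).
  by rewrite /W; case: insub => [l|] //; apply: pq_form_pullback.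
have sumW (c : nat -> R[i]) : \sum_(k < n) c k *: W k
    = \sum_(l < nt) c l *: pullback pi (wt l) + \sum_(k < n - nt) c (nt + k)%N *: th k.
  rewrite (big_ord_cat (fun k => c k *: W k) nt_le_n).
  by congr (_ + _); apply: eq_bigr => k _; rewrite ?W1 ?W2.
have pull_sum (c : 'I_nt -> R[i]) :
    \sum_l c l *: pullback pi (wt l) = pullback pi (\sum_l c l *: wt l).
  by apply/funext=> s; rewrite /pullback !cform_sum.
exists (fun k => W k); split; last first.
  rewrite FtE /F' /vertical_form scaler_sumr.
  rewrite (big_ord_geq (fun k => _ *: wedge (W k) (conj_form (W k))) nt_le_n).
  rewrite -[LHS](subrK (\sum_(k < n - nt) square_form (th k))); congr (_ + _).
  by apply: eq_bigr => k _; rewrite W2.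
(* On [K] the pulled back forms vanish, so the coefficients of the [th k] are zero; the remaining
   relation descends to [h], where the expansion of 0 is unique. *)
have unW (c : nat -> R[i]) : \sum_(k < n) c k *: W k = 0 -> forall k, (k < n)%N -> c k = 0.
  rewrite sumW => E.
  have c2 k : (k < n - nt)%N -> c (nt + k)%N = 0.
    apply: (unth (fun k => c (nt + k)%N)) => v vK.
    have := congr1 (fun a : cform g => a [:: v]) E; rewrite cformD cform0 !cform_sum.
    rewrite big1 ?add0r // => l _; rewrite cformZ /pullback /=.
    have -> : pi v = 0 by apply/eqP; rewrite -memv_ker.
    by rewrite mlin_mem0 ?mulr0 ?mem_head //; have /is_pq_formP[[]] := pwt l.
  move: E; rewrite [X in _ + X]big1 ?addr0 => [|k _]; last by rewrite c2 ?scale0r.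
  rewrite (pull_sum (fun l : 'I_nt => c l)) => E.
  have E0 : \sum_(l < nt) c l *: wt l = 0 by apply: (pullback_inj pi_surj); rewrite E.
  have [c0 [c0E c0U]] := spanwt 0 (pq_form0 _ _ _).
  have U1 := c0U [ffun l : 'I_nt => c l]; have U2 := c0U [ffun => 0].
  have cc : [ffun l : 'I_nt => c l] = [ffun => 0] :> {ffun 'I_nt -> R[i]}.
    rewrite -U1 ?U2 //; first by rewrite big1 // => l _; rewrite ffunE scale0r.
    by rewrite -[LHS]E0; apply: eq_bigr => l _; rewrite ffunE.
  move=> k kn; have [kt|tk] := ltnP k nt; last first.
    by rewrite -(subnKC tk) c2 // ltn_sub2r // (leq_ltn_trans tk).
  by have := congr1 (fun f : {ffun _} => f (Ordinal kt)) cc; rewrite !ffunE.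
split.
- split=> [k|a pa]; first exact: pW.
  have /is_pq_formP[aa _] := pa; have [|c cE] := exth a pa.
    move=> v; rewrite memv0 => /eqP ->; apply: mlin_mem0; last by rewrite mem_head.
    by case: aa.
  (* The sum matches [a] on [K], so [a'] vanishes there and descends to a (1,0)-form on [h]. *)
  pose a' := a - \sum_(k < n - nt) c k *: th k.
  have pa' : is_pq_form J 1 0 a'.
    apply: pq_formB => //; apply: (big_ind (is_pq_form J 1 0)); first exact: pq_form0.
      by move=> ? ?; apply: pq_formD.
    by move=> k _; apply: pq_formZ.
  have [/is_formP[aa' ha'] _] := pa'.
  have a'E : pullback pi (pullback sg a') = a'.
    apply: descent1 => // v vK; rewrite /a' cformD cformN cform_sum (cE v vK).
    by rewrite subrr.
  have pal := pq_form_descent pa' (altern_pullback sg aa') a'E.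
  have [ct [ctE _]] := spanwt _ pal.
  pose C k := if insub k is Some l then ct l else c (k - nt)%N.
  have CE : a = \sum_(k < n) C k *: W k.
    rewrite sumW -[LHS](subrK (\sum_(k < n - nt) c k *: th k)) -/a'; congr (_ + _).
      rewrite -a'E ctE -pull_sum; apply: eq_bigr => l _.
      by rewrite /C valK.
    apply: eq_bigr => k _; rewrite /C insubF ?addKn //.
    by apply/negbTE; rewrite -leqNgt leq_addr.
  exists [ffun k : 'I_n => C k]; split.
    by rewrite [LHS]CE; apply: eq_bigr => k _; rewrite ffunE.
  move=> c2 c2E; apply/ffunP => k; rewrite ffunE; apply/eqP; rewrite -subr_eq0.
  (* [unW] takes coefficients on [nat]; the default 0 is never reached in a sum over ['I_n]. *)
  pose c2n l := if insub l is Some i then c2 i else 0.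
  have := unW (fun l => C l - c2n l); move/(_ _ k (ltn_ord k)).
  rewrite /c2n valK => -> //; under eq_bigr do rewrite scalerBl.
  rewrite sumrB -CE {1}c2E; apply/eqP; rewrite subr_eq0; apply/eqP.
  by apply: eq_bigr => l _; rewrite valK.
- by move=> k l kl; rewrite kl W1.
move=> j; have [/is_formP[aj hj] _] := pW j.
split; last first.
  rewrite !type_compE {1}(homog2_split J (homog_dform aj hj)).
  by rewrite (dform10_type JJ cJ.2 (pW j)) addr0.
(* [K] is central, so d(W j) vanishes as soon as one argument lies in [K]. It thus descends to a
   2-form on [h], which is expanded there on [wt] and its conjugates. *)
have dE : pullback pi (pullback sg (dform (W j))) = dform (W j).
  apply: descent2; [exact: altern_dform|exact: homog_dform|].
  move=> v y vK; rewrite dform1 // (lie_mem_l K_cent) //.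
  by rewrite mlin_mem0 ?oppr0 ?mem_head //; case: aj.
have asd : altern (pullback sg (dform (W j))).
  by apply: altern_pullback; apply: altern_dform.
have hsd : homog 2 (pullback sg (dform (W j))).
  by apply: homog_pullback; apply: homog_dform.
have [c cE] := two_form_span JJh wtB asd hsd.
exists c; rewrite -dE cE; apply/funext=> s; rewrite /pullback !cform_sum.
apply: eq_bigr => x _; rewrite !cform_sum; apply: eq_bigr => y _; rewrite !cformZ.
congr (_ * _); rewrite -/(pullback pi _ s) !wedgeE pullbackM.
by case: x; case: y.
Qed.

End AdaptedBasis.

Theorem proposition5p2 (R : realType) (g : lieAlgebra R) (J : 'End(g))
    (n : nat) (F : cform g)
    (dim_g : \dim {:g} = (2 * n)%N) (dim_ge4 : (4 <= 2 * n)%N)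
    (nil_g : lie_nilpotent g)
    (cplx_J : complex_structure J) (qnil_J : quasi_nilpotent J)
    (herm_F : hermitian_metric J F) :
  (exists (nt : nat) (h : lieAlgebra R) (Jh : 'End(h)) (pi : 'Hom(g, h)),
     [/\ \dim {:h} = (2 * nt)%N, lie_nilpotent h, complex_structure Jh
       & central_extension J Jh pi])
  /\
  (forall (nt : nat) (h : lieAlgebra R) (Jh : 'End(h)) (pi : 'Hom(g, h)),
     \dim {:h} = (2 * nt)%N -> lie_nilpotent h -> complex_structure Jh ->
     central_extension J Jh pi ->
     (exists Ft : cform h,
        hermitian_metric Jh Ft /\
        forall wt : 'I_nt -> cform h, basis_10 Jh wt ->
          exists w : 'I_n -> cform g,
            adapted_basis J pi wt w /\
            F = pullback pi Ft + vertical_form nt w)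
     /\
     (forall (Ft : cform h) (wt : 'I_nt -> cform h) (w : 'I_n -> cform g),
        hermitian_metric Jh Ft -> basis_10 Jh wt -> adapted_basis J pi wt w ->
        F = pullback pi Ft + vertical_form nt w ->
        let D := vertical_form nt w in
        let b := (n - nt)%N in
        let N : int := n%:Z in
        let B : int := b%:Z in
        let z (k : int) : R[i] := k%:~R in
        let C (p q : nat) : R[i] := 'C(p, q)%:R in
        (balanced F <->
           balanced Ft /\
           ((z (B - 1) * C (n - 1)%N (b - 1)%N)
                *: (pullback pi (Ft ^^w (N - B)) ^w D ^^w (B - 2))
            + (z B * C (n - 1)%N b)
                *: (pullback pi (Ft ^^w (N - 1 - B)) ^w D ^^w (B - 1)))
           ^w dform D = 0)
        /\
        (astheno_kahler J F <->
           astheno_kahler Jh Ft /\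
           0 =
             ((z B * C (n - 2)%N b)
                *: (pullback pi (delbar Jh (Ft ^^w (N - 2 - B)))
                      ^w D ^^w (B - 1))
              + (z (B - 1) * C (n - 2)%N (b - 1)%N)
                *: (pullback pi (delbar Jh (Ft ^^w (N - 1 - B)))
                      ^w D ^^w (B - 2)))
             ^w del J D
           - ((z B * C (n - 2)%N b)
                *: (pullback pi (del Jh (Ft ^^w (N - 2 - B)))
                      ^w D ^^w (B - 1))
              + (z (B - 1) * C (n - 2)%N (b - 1)%N)
                *: (pullback pi (del Jh (Ft ^^w (N - 1 - B)))
                      ^w D ^^w (B - 2)))
             ^w delbar J D
           - ((z B * z (B - 1) * C (n - 2)%N b)
                *: (pullback pi (Ft ^^w (N - 2 - B)) ^w D ^^w (B - 2))
              + (z (B - 1) * z (B - 2) * C (n - 2)%N (b - 1)%N)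
                *: (pullback pi (Ft ^^w (N - 1 - B)) ^w D ^^w (B - 3))
              + (z (B - 2) * z (B - 3) * C (n - 2)%N (b - 2)%N)
                *: (pullback pi (Ft ^^w (N - B)) ^w D ^^w (B - 4)))
             ^w del J D ^w delbar J D
           - ((z B * C (n - 2)%N b)
                *: (pullback pi (Ft ^^w (N - 2 - B)) ^w D ^^w (B - 1))
              + (z (B - 1) * C (n - 2)%N (b - 1)%N)
                *: (pullback pi (Ft ^^w (N - 1 - B)) ^w D ^^w (B - 2))
              + (z (B - 2) * C (n - 2)%N (b - 2)%N)
                *: (pullback pi (Ft ^^w (N - B)) ^w D ^^w (B - 3)))
             ^w del J (delbar J D)))).

Proof.
have JJ := cplx_J.1; split; first exact: (exists_central_extension JJ dim_g).
move=> nt h Jh pi dim_h nil_h cJh [[K [_ K_cent K_J [K0 KT] KE]] [pi_surj pi_lie pi_J]].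
subst K; split; first exact: (exists_adapted_basis cplx_J cJh dim_g dim_h).
move=> Ft wt w hFt wtB [[pw _] _ _] FE D b N B z C.
have Dnil : D ^+ (n - nt).+1 = 0.
  by apply: vertical_form_nil => k; have [/is_formP[]] := pw k.
split.
- exact: (balanced_iff JJ cJh.1 dim_g dim_h K_cent K_J K0 KT pi_surj pi_lie pi_J
    herm_F hFt FE Dnil).
- exact: (astheno_iff JJ cJh.1 dim_g dim_h nil_h K_cent K_J K0 KT pi_surj pi_lie pi_J
    herm_F hFt FE Dnil).
Qed.
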